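(* The generalised left Fischer cover, viewed as the cover $X\mapsto(\mathrm{cov}(X),\pi_{\mathrm{cov}(X)})$ on the class of all sofic shifts, where $\mathrm{cov}(X)=\mathsf{X}_{G_X}$ is the edge shift of the underlying graph of the generalised left Fischer cover $(G_X,\mathcal{L}_X)$ of $X$ and $\pi_{\mathrm{cov}(X)}((e_i)_i)=(\mathcal{L}_X(e_i))_i$, is flow invariant.
   Context: A shift space over a finite alphabet $\mathcal{A}$ is a closed shift-invariant subset $X\subseteq\mathcal{A}^{\mathbb{Z}}$; $\mathcal{A}(X)$ is its alphabet. A conjugacy is a shift-commuting homeomorphism. $X^-$ and $X^+$ denote the sets of left-rays $\cdots x_{-2}x_{-1}$ and right-rays $x_0x_1\cdots$ of elements of $X$, and $P_\infty(x^+)=\{y^-\in X^-\mid y^-x^+\in X\}$ for $x^+\in X^+$. A labelled graph $(E,\mathcal{L})$ is a directed graph $E=(E^0,E^1,r,s)$ with a labelling $\mathcal{L}\colon E^1\to\mathcal{A}$; the edge shift of a finite graph is $\mathsf{X}_E=\{e\in(E^1)^{\mathbb{Z}}\mid r(e_i)=s(e_{i+1})\}$; $(E,\mathcal{L})$ presents $\{(\mathcal{L}(e_i))_i\mid e\in\mathsf{X}_E\}$; a shift space is sofic if presented by a finite labelled graph. A shift of finite type (SFT) is a shift space defined by a finite set of forbidden words. Left Krieger cover of a sofic shift $X$: the labelled graph $(K,\mathcal{L}_K)$ with $K^0=\{P_\infty(x^+)\mid x^+\in X^+\}$ and an edge labelled $a$ from $P$ to $P'$ iff there is $x^+\in X^+$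 with $P=P_\infty(ax^+)$, $P'=P_\infty(x^+)$. $P\in K^0$ is indecomposable if $V\subseteq K^0$, $P=\bigcup_{Q\in V}Q$ imply $P\in V$. Write $P\geq P'$ if there is a (possibly trivial) path in $K$ from $P$ to $P'$. The generalised left Fischer cover of $X$ is the labelled subgraph of $(K,\mathcal{L}_K)$ induced by $\{P\in K^0\mid P\ge P'\text{ for some indecomposable }P'\}$. Symbol expansion: for a shift space $Z$ and $A\subseteq\mathcal{A}(Z)$ introduce new symbols $\diamond_a$, $a\in A$. Let $\tau_A(a)=a\diamond_a$ for $a\in A$, $\tau_A(b)=b$ otherwise, and let $\exp_A(\cdots x_{-1}.x_0x_1\cdots)=\cdots\tau_A(x_{-1}).\tau_A(x_0)\tau_A(x_1)\cdots$ (the period is to the left of coordinate $0$). Put $Z^{\exp_A}=\exp_A(Z)\cup\sigma(\exp_A(Z))$, a shift space. For $A=\{a\}$ write $\exp_a$ and $Z^{a\mapsto a\diamond}=Z^{\exp_a}$. A cover on a class $S$ of sofic shifts assigns to each $X\in S$ an SFT $\mathrm{cov}(X)$ and a surjective continuous shift-commuting map $\pi_{\mathrm{cov}(X)}\colon\mathrm{cov}(X)\to X$. The cover is canonical if for $X,Y\in S$ and every conjugacy $\varphi\colon X\to Y$ there is a unique conjugacy $\mathrm{cov}(\varphi)\colon\mathrm{cov}(X)\to\mathrm{cov}(Y)$ with $\pi_{\mathrm{cov}(Y)}\circ\mathrm{cov}(\varphi)=\varphi\circ\pi_{\mathrm{cov}(X)}$. The cover respects symbol expansion if for all $X\in S$,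 $a\in\mathcal{A}(X)$, $\diamond\notin\mathcal{A}(X)$ there is a map $\mathcal{L}\colon\mathcal{A}(\mathrm{cov}(X))\to\mathcal{A}(X)$ such that $\pi_{\mathrm{cov}(X)}((y_n)_n)=(\mathcal{L}(y_n))_n$ for all $y\in\mathrm{cov}(X)$, and such that, with $A=\mathcal{L}^{-1}(\{a\})$, there is a conjugacy $\varphi\colon\mathrm{cov}(X^{a\mapsto a\diamond})\to(\mathrm{cov}(X))^{\exp_A}$ with $\pi_{\mathrm{cov}(X^{a\mapsto a\diamond})}(\varphi^{-1}(\exp_A(y)))=\exp_a(\pi_{\mathrm{cov}(X)}(y))$ for all $y\in\mathrm{cov}(X)$. A cover is flow invariant if it is canonical and respects symbol expansion. *)

(* Defs.v *)
From HB Require Import structures.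
From Stdlib Require Import Relations.
From mathcomp Require Import all_boot all_order all_algebra.
From mathcomp Require Import finmap.
From mathcomp Require Import boolp classical_sets functions cardinality.
From mathcomp Require Import topology.

Set Implicit Arguments.
Unset Strict Implicit.
Unset Printing Implicit Defensive.

Import GRing.Theory.

Local Open Scope classical_set_scope.
Local Open Scope ring_scope.

Notation fullshift A := (prod_topology (fun _ : int => discrete_topology A)).

Definition shift (A : choiceType) (x : fullshift A) : fullshift A :=
  fun i => x (i + 1).

Definition shift_space (A : finType) (X : set (fullshift A)) : Prop :=
  closed X /\ (forall x, X x <-> X (shift x)).

Definition symbols (A : finType) (X : set (fullshift A)) : set A :=
  [set a | exists x i, X x /\ x i = a].

Definition occurs (A : finType) (w : seq A) (x : fullshift A) : Prop :=
  exists i : int, w = [seq x (i + j%:Z) | j <- iota 0 (size w)].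

Definition sft (A : finType) (X : set (fullshift A)) : Prop :=
  shift_space X /\
  exists F : seq (seq A), X = [set x | forall w, w \in F -> ~ occurs w x].

(** A subset [X] is coerced to the type of its points, which carries the
    subspace topology.  All shift spaces below are shift invariant, so that [x']
    always exists in the next definition. *)
Definition shift_commuting (A B : finType)
    (X : set (fullshift A)) (Y : set (fullshift B)) (f : X -> Y) : Prop :=
  forall x x' : X, \val x' = shift (\val x) -> \val (f x') = shift (\val (f x)).

Definition inverse_conjugacies (A B : finType)
    (X : set (fullshift A)) (Y : set (fullshift B))
    (f : X -> Y) (g : Y -> X) : Prop :=
  [/\ shift_commuting f, continuous f, continuous g, cancel f g & cancel g f].

Definition conjugacy (A B : finType)
    (X : set (fullshift A)) (Y : set (fullshift B)) (f : X -> Y) : Prop :=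
  exists g : Y -> X, inverse_conjugacies f g.

Record lgraph (A : Type) := LGraph {
  vertex : choiceType;
  edge : choiceType;
  src : edge -> vertex;
  tgt : edge -> vertex;
  label : edge -> A }.

Definition finite_graph (A : Type) (G : lgraph A) : Prop :=
  finite_set [set: vertex G] /\ finite_set [set: edge G].

(** [fset_set] is the identity on finite sets (and empty otherwise): for a
    finite graph [G] this is the set of all edges of [G]. *)
Definition edge_alphabet (A : Type) (G : lgraph A) : finType :=
  fset_set [set: edge G].

Definition edge_shift (A : Type) (G : lgraph A) :
    set (fullshift (edge_alphabet G)) :=
  [set e | forall i : int, tgt (\val (e i)) = src (\val (e (i + 1)))].
Arguments edge_shift {A} G _.

Definition label_map (A : finType) (G : lgraph A)
    (e : edge_shift G) : fullshift A :=
  fun i => label (\val (\val e i)).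

Definition presents (A : finType) (G : lgraph A) (X : set (fullshift A)) :=
  X = range (@label_map A G).

Definition sofic (A : finType) (X : set (fullshift A)) : Prop :=
  shift_space X /\ exists G : lgraph A, finite_graph G /\ presents G X.

Definition induced (A : Type) (G : lgraph A) (W : set (vertex G)) : lgraph A :=
  @LGraph A (W : Type)
    ([set e : edge G | W (src e) /\ W (tgt e)] : Type)
    (fun e => exist _ (src (\val e)) (mem_set (set_mem (valP e)).1))
    (fun e => exist _ (tgt (\val e)) (mem_set (set_mem (valP e)).2))
    (fun e => label (\val e)).

Definition reaches (A : Type) (G : lgraph A) : vertex G -> vertex G -> Prop :=
  clos_refl_trans (vertex G)
    (fun v w => exists e : edge G, src e = v /\ tgt e = w).

(** The right-ray [x_0 x_1 ...] is [fun n => x_n] and the left-ray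
    [... x_{-2} x_{-1}] is [fun n => x_{-(n+1)}]; recall [Negz n = - n.+1]. *)
Definition ray (A : Type) := nat -> A.

Definition right_ray (A : finType) (x : fullshift A) : ray A :=
  fun n => x (Posz n).

Definition left_ray (A : finType) (x : fullshift A) : ray A :=
  fun n => x (Negz n).

Definition right_rays (A : finType) (X : set (fullshift A)) : set (ray A) :=
  @right_ray A @` X.

Definition left_rays (A : finType) (X : set (fullshift A)) : set (ray A) :=
  @left_ray A @` X.

Definition glue (A : finType) (y x : ray A) : fullshift A :=
  fun i => match i with Posz n => x n | Negz n => y n end.

Definition ray_cons (A : Type) (a : A) (x : ray A) : ray A :=
  fun n => if n is m.+1 then x m else a.

Definition pred_set (A : finType) (X : set (fullshift A)) (x : ray A) :
    set (ray A) :=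
  [set y | left_rays X y /\ X (glue y x)].

Definition krieger_vertices (A : finType) (X : set (fullshift A)) :
    set (set (ray A)) :=
  [set pred_set X x | x in right_rays X].
Arguments krieger_vertices {A} X _.

(** An edge from [P] to [Q] labelled [a] is the triple [(P, a, Q)].  Elements of
    [krieger_vertices X] are nonempty, so that [ray_cons a x] is automatically
    in [right_rays X]. *)
Definition krieger_edges (A : finType) (X : set (fullshift A)) :
    set (krieger_vertices X * A * krieger_vertices X) :=
  [set e | exists x, [/\ right_rays X x,
             \val e.1.1 = pred_set X (ray_cons e.1.2 x) &
             \val e.2 = pred_set X x]].
Arguments krieger_edges {A} X _.

Definition krieger_cover (A : finType) (X : set (fullshift A)) : lgraph A :=
  @LGraph A (krieger_vertices X : Type) (krieger_edges X : Type)
    (fun e => (\val e).1.1) (fun e => (\val e).2) (fun e => (\val e).1.2).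

Definition indecomposable (A : finType) (X : set (fullshift A))
    (P : vertex (krieger_cover X)) : Prop :=
  forall V : set (vertex (krieger_cover X)),
    \val P = \bigcup_(Q in V) \val Q -> V P.

Definition gen_fischer_cover (A : finType) (X : set (fullshift A)) : lgraph A :=
  @induced A (krieger_cover X)
    [set P | exists Q, indecomposable Q /\ reaches P Q].

Lemma finite_krieger_vertices (A : finType) (X : set (fullshift A)) :
  sofic X -> finite_set [set: vertex (krieger_cover X)].
Proof.
move=> [_ [G [[fv fe] XG]]].
pose E := edge_alphabet G.
pose FV := fset_set [set: vertex G].
have FVin v : v \in FV by rewrite in_fset_set // inE.
pose Vx (x : ray A) : {set FV} := [set v : FV | `[< exists e : nat -> E,
   [/\ src (\val (e 0%N)) = \val v,
   forall n, tgt (\val (e n)) = src (\val (e n.+1))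
   & forall n, label (\val (e n)) = x n] >]]%SET.
pose L (W : {set FV}) : set (ray A) := [set y | exists2 v : FV, v \in W &
   exists e : nat -> E, [/\ tgt (\val (e 0%N)) = \val v,
   forall n, tgt (\val (e n.+1)) = src (\val (e n))
   & forall n, label (\val (e n)) = y n]].
have PL x : pred_set X x = L (Vx x).
  apply/seteqP; split => y.
    move=> [_]; rewrite XG => -[e _ ey].
    have eE i : label (\val (\val e i)) = glue y x i by rewrite -ey.
    have ee := set_mem (valP e).
    exists (FSetSub (FVin (src (\val (\val e 0))))).
      rewrite inE; apply/asboolP; exists (fun n => \val e (Posz n)).
      split => //= n.
        by rewrite (ee n) -addn1 PoszD.
      by rewrite eE.
    exists (fun n => \val e (Negz n)); split => /=.
    - by rewrite (ee (Negz 0)).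
    - by move=> n; rewrite (ee (Negz n.+1)); congr (src (\val (\val e _)));
        rewrite !NegzE -[n.+2]addn1 PoszD opprD addrNK.
    - by move=> n; rewrite eE.
  move=> [v]; rewrite inE => /asboolP [e [e0 e1 e2]] [f [f0 f1 f2]].
  have Xg : X (glue y x).
    pose g : fullshift E :=
      fun i => match i with Posz n => e n | Negz n => f n end.
    have gin : g \in edge_shift G.
      apply/mem_set => -[n|[|n]].
      - by rewrite -PoszD addn1 /= e1.
      - by rewrite /= f0 e0.
      - have -> : Negz n.+1 + 1 = Negz n.
          by rewrite !NegzE -[n.+2]addn1 PoszD opprD addrNK.
        by rewrite /= f1.
    rewrite XG; exists (exist _ g gin) => //.
    by apply: funext => -[n|n]; rewrite /label_map /= ?e2 ?f2.
  split => //; exists (glue y x) => //.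
have fK : finite_set (krieger_vertices X).
  apply: (@sub_finite_set _ _ (L @` [set: {set FV}])).
    by move=> _ [x _ <-]; exists (Vx x).
  exact/finite_image/finite_finset.
by rewrite (eq_finite_set (card_setT _)).
Qed.

Lemma finite_krieger_edges (A : finType) (X : set (fullshift A)) :
  sofic X -> finite_set [set: edge (krieger_cover X)].
Proof.
move=> /finite_krieger_vertices fv.
rewrite (eq_finite_set (card_setT _)).
apply: (@sub_finite_set _ _ (([set: vertex (krieger_cover X)] `*` [set: A])
    `*` [set: vertex (krieger_cover X)])) => //.
by apply: finite_setX => //; apply: finite_setX.
Qed.

(** Hence [edge_alphabet (gen_fischer_cover X)] is the full set of edges when
    [X] is sofic. *)
Lemma finite_gen_fischer (A : finType) (X : set (fullshift A)) :
  sofic X -> finite_graph (gen_fischer_cover X).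
Proof.
move=> sX; have fe := finite_krieger_edges sX.
have fv := finite_krieger_vertices sX.
by split; rewrite (eq_finite_set (card_setT _));
  [apply: sub_finite_set fv|apply: sub_finite_set fe].
Qed.

(** [iota : A -> B] views the old symbols inside the new alphabet [B], and
    [diam a : B] is the new symbol inserted after [a], for [a] in [D]. *)
Definition tau (A B : finType) (iota diam : A -> B) (D : set A) (a : A) :
    seq B :=
  if a \in D then [:: iota a; diam a] else [:: iota a].

(** [... tau(x_{-2}) tau(x_{-1}) . tau(x_0) tau(x_1) ...]; words left of the
    period are reversed because they are read off leftwards.  Since no [tau a]
    is empty, the default value of [nth] is never used. *)
Definition expand (A B : finType) (iota diam : A -> B) (D : set A)
    (x : fullshift A) : fullshift B :=
  let t a := tau iota diam D a in
  fun i => match i with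
  | Posz m =>
      nth (iota (x 0)) (flatten (mkseq (fun k => t (x (Posz k))) m.+1)) m
  | Negz m =>
      nth (iota (x 0)) (flatten (mkseq (fun k => rev (t (x (Negz k)))) m.+1)) m
  end.

Definition expansion (A B : finType) (iota diam : A -> B) (D : set A)
    (Z : set (fullshift A)) : set (fullshift B) :=
  (expand iota diam D @` Z) `|` (@shift B @` (expand iota diam D @` Z)).
Arguments expansion {A B} iota diam D Z _.

Lemma expand_in (A B : finType) (iota diam : A -> B) (D : set A)
    (Z : set (fullshift A)) (z : Z) :
  expand iota diam D (\val z) \in expansion iota diam D Z.
Proof. by apply/mem_set; left; exists (\val z) => //; exact: set_valP. Qed.

Definition expand_pt (A B : finType) (iota diam : A -> B) (D : set A)
    (Z : set (fullshift A)) (z : Z) : expansion iota diam D Z :=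
  exist _ (expand iota diam D (\val z)) (expand_in iota diam D z).

Definition shift_class := forall A : finType, set (fullshift A) -> Prop.

Record cover_data := CoverData {
  cov_alphabet : forall A : finType, set (fullshift A) -> finType;
  cov : forall (A : finType) (X : set (fullshift A)),
    set (fullshift (cov_alphabet X));
  cov_map : forall (A : finType) (X : set (fullshift A)),
    @cov A X -> fullshift A }.
Arguments cov c {A} X _.

Definition is_cover (S : shift_class) (c : cover_data) : Prop :=
  forall (A : finType) (X : set (fullshift A)), S A X ->
    [/\ sft (cov c X),
        range (@cov_map c A X) = X,
        continuous (@cov_map c A X) &
        forall y y' : cov c X, \val y' = shift (\val y) ->
          cov_map y' = shift (cov_map y)].

Definition canonical (S : shift_class) (c : cover_data) : Prop :=
  forall (A B : finType) (X : set (fullshift A)) (Y : set (fullshift B)),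
  S A X -> S B Y ->
  forall phi : X -> Y, conjugacy phi ->
  exists! psi : cov c X -> cov c Y,
    conjugacy psi /\
    forall (y : cov c X) (x : X), \val x = cov_map y ->
      cov_map (psi y) = \val (phi x).

(** The alphabet of [X^(a |-> a diam)] is any [B] into which [symbols X] embeds
    (via [iota]), with [diam] any symbol outside the image of [symbols X]; for
    the expansion of the cover the new symbols are the right summand. *)
Definition respects_symbol_expansion (S : shift_class) (c : cover_data) :
    Prop :=
  forall (A : finType) (X : set (fullshift A)), S A X ->
  forall (B : finType) (iota : A -> B) (diam : B) (a : A),
  set_inj (symbols X) iota -> symbols X a -> ~ (iota @` symbols X) diam ->
  exists L : cov_alphabet c X -> A,
    [/\ set_fun (symbols (cov c X)) (symbols X) L,
        forall y : cov c X, cov_map y = (fun n => L (\val y n)) &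
        let D := symbols (cov c X) `&` L @^-1` [set a] in
        let X' := expansion iota (fun=> diam) [set a] X in
        let E := expansion inl inr D (cov c X) in
        exists (phi : cov c X' -> E) (phiV : E -> cov c X'),
          inverse_conjugacies phi phiV /\
          forall y : cov c X,
            cov_map (phiV (expand_pt inl inr D y)) =
            expand iota (fun=> diam) [set a] (cov_map y)].

Definition flow_invariant (S : shift_class) (c : cover_data) : Prop :=
  canonical S c /\ respects_symbol_expansion S c.

Definition gen_fischer : cover_data :=
  @CoverData
    (fun A X => edge_alphabet (gen_fischer_cover X))
    (fun A X => edge_shift (gen_fischer_cover X))
    (fun A X => @label_map A (gen_fischer_cover X)).

(* Main.v *)
(** A point of the cover of [X] is a label sequence [x] with vertices [P_i], where
    [P_i] consists of the left rays [y] such that [y x_i] is in [P_(i+1)].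

    If [phi] is a conjugacy whose block maps, both ways, have radius [r], and [w]
    is a point of [X], then the past of [phi w] at [i] is determined by the past of
    [w] at [i + 3 r] and by [w] near [i]; cutting a vertex of [Y] into
    indecomposable ones and pulling them back along [phi] shows that this sends
    vertices of the cover to vertices of the cover.  Hence the past assignment
    is a block code, and so is the one for the inverse of [phi]: together they
    form the lift.  The lift is unique because a vertex of a lift is the set of
    left rays of the points right asymptotic to it.

    For a symbol expansion, every vertex of the cover of the new shift is the
    expansion of a vertex of the old one, possibly followed by the letter [a] that
    is about to be completed; the former kind is indecomposable exactly when the
    old vertex is. *)
From HB Require Import structures.
From Stdlib Require Import Relations.
From mathcomp Require Import all_boot all_order all_algebra.
From mathcomp Require Import finmap.
From mathcomp Require Import boolp classical_sets functions cardinality.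
From mathcomp Require Import topology function_spaces.
From mathcomp Require Import zify.
Require Import Defs.

Set Implicit Arguments.
Unset Strict Implicit.
Unset Printing Implicit Defensive.

Import Order.TTheory GRing.Theory Num.Theory.

Local Open Scope classical_set_scope.
Local Open Scope ring_scope.

(** * Topology of full shifts *)

(** In the Krieger cover the label of an edge and its target determine its source. Knowledge of a
    vertex therefore travels to the left only, and every comparison of vertices starts at a position
    far enough to the right.

    The vertices of a point of the cover need not be the pasts of one single point of [X]: each
    [P i] is the past of some [w] that continues the labels left of [i], and [w] varies with [i].
    This is why cover points and lifts are described by witnesses chosen separately at each
    position.

    Comparing pasts across a conjugacy costs three radii. An indecomposable past at [i + 3 r] thus
    yields at [i] a vertex from which an indecomposable one can be reached further right; the notion
    carried along a conjugacy is [good], not [indec].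

    Finiteness of the set of vertices supplies minimal vertices: every left ray of a vertex lies in
    an indecomposable vertex below it. This is what allows a vertex to be cut into indecomposable
    pieces. For a symbol expansion the finiteness comes from the explicit list of its vertices. *)

Definition eqon (T : Type) (a b : int) (x y : int -> T) : Prop :=
  forall i, a <= i -> i < b -> x i = y i.

Section Eqon.
Variables (T : Type).
Implicit Types (x y z : int -> T).

Lemma eqon_sym a b x y : eqon a b x y -> eqon a b y x.
Proof. by move=> h i ai ib; rewrite h. Qed.

Lemma eqon_trans a b x y z : eqon a b x y -> eqon a b y z -> eqon a b x z.
Proof. by move=> h k i ai ib; rewrite h // k. Qed.

Lemma eqon_sub a b a' b' x y : a <= a' -> b' <= b ->
  eqon a b x y -> eqon a' b' x y.
Proof.
move=> aa bb h i ai ib.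
by apply: h; [apply: le_trans ai | apply: lt_le_trans bb].
Qed.

End Eqon.

Section FullShiftTopology.
Variable (A : choiceType).
Implicit Types (x y : fullshift A) (U : set (fullshift A)).

Lemma nbhs_eqon x (M : nat) : nbhs x [set y | eqon (- M%:Z) M%:Z x y].
Proof.
have Fx : Filter (nbhs x) by exact: nbhs_filter.
have n1 i : nbhs x [set y | x i = y i].
  have := @proj_continuous int (fun _ => discrete_topology A) i x.
  move=> /(_ [set x i]).
  rewrite /nbhs /= => /(_ (@discrete_set1 (discrete_topology A) (x i))).
  by apply: (@filterS _ _ Fx) => y /= e; symmetry.
elim: M => [|M IH].
  by apply: (@filterE _ _ Fx) => y i; lia.
apply: (@filterS _ _ Fx) (filterI IH (filterI (n1 M%:Z) (n1 (- (M.+1)%:Z)))).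
move=> y [h [h1 h2]] i iM Mi.
have [->//|?] := eqVneq i M%:Z.
have [->//|?] := eqVneq i (- (M.+1)%:Z).
by apply: h; lia.
Qed.

Lemma nbhs_fullshiftP x U :
  nbhs x U <-> exists M : nat, [set y | eqon (- M%:Z) M%:Z x y] `<=` U.
Proof.
split; last first.
  by move=> [M MU]; apply: (@filterS _ _ (nbhs_filter x)) (nbhs_eqon x M).
pose F : set_system (fullshift A) :=
  [set B | exists M : nat, [set y | eqon (- M%:Z) M%:Z x y] `<=` B].
have FF : Filter F.
  split.
  - by exists 0%N.
  - move=> B C [M MB] [N NC]; exists (maxn M N) => y /= h; split.
    + by apply: MB; apply: eqon_sub h; lia.
    + by apply: NC; apply: eqon_sub h; lia.
  - by move=> B C BC [M MB]; exists M; apply: subset_trans BC.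
have : F --> x.
  apply/cvg_sup => i B [_ [[W oW <-] Wx] WB].
  exists (`|i|.+1) => y h; apply: WB => /=.
  change (W (y i)); rewrite -h; [exact: Wx | lia | lia].
by apply.
Qed.

Lemma closed_eqonP (X : set (fullshift A)) : closed X <->
  forall x, (forall M : nat, exists2 y, X y & eqon (- M%:Z) M%:Z x y) -> X x.
Proof.
split.
- move=> cX x h; apply: cX => U /nbhs_fullshiftP [M MU].
  by have [y Xy xy] := h M; exists y; split => //; apply: MU.
- move=> h x xX; apply: h => M.
  by have [y [Xy xy]] := xX _ (nbhs_eqon x M); exists y.
Qed.

End FullShiftTopology.

Lemma fullshift_compact (A : finType) : compact [set: fullshift A].
Proof.
have := @tychonoff int (fun _ => discrete_topology A) (fun _ => setT).
have -> : [set f : int -> A | forall i : int, [set: A] (f i)] = setT.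
  by apply/seteqP; split.
by apply => i; apply: finite_compact; exact: finite_finset.
Qed.

(** Compactness in the form used twice: for the radius of a continuous shift-commuting map and for
    the surjectivity of the covering map. *)
Lemma cluster_seq (A : finType) (X : set (fullshift A)) (u : nat -> fullshift A) :
  closed X -> (forall n, X (u n)) ->
  exists2 x, X x &
    forall M : nat, exists2 n : nat, (M <= n)%N & eqon (- M%:Z) M%:Z x (u n).
Proof.
move=> cX Xu; have cpX : compact X.
  by apply: subclosed_compact (@fullshift_compact A) _.
have [|x [Xx cx]] := cpX (u @ \oo) _.
  by exists 0%N => // n _; apply: Xu.
exists x => // M.
have [|_ [[n Mn <-] xn]] := cx (u @` [set n | (M <= n)%N]) _ _ (nbhs_eqon x M).
  by exists M => // n Mn; exists n.
by exists n.
Qed.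

Lemma nbhs_set_typeP (A : choiceType) (X : set (fullshift A)) (x : X)
    (U : set X) : nbhs x U <->
  exists M : nat, [set y : X | eqon (- M%:Z) M%:Z (\val x) (\val y)] `<=` U.
Proof.
split.
- move=> [_ [[W oW <-] Wx] WU].
  have /nbhs_fullshiftP [M MW] : nbhs (\val x) W by apply: open_nbhs_nbhs.
  by exists M => y xy; apply: WU; apply: MW.
- move=> [M MU].
  apply: (@filterS _ _ (nbhs_filter x) _ _ MU).
  exact: (@initial_continuous X (fullshift A) set_val x _ (nbhs_eqon _ M)).
Qed.

Section ContinuityOfRestrictions.
Variables (A : choiceType) (X : set (fullshift A)).

Lemma continuous_fullshiftP (B : choiceType) (f : X -> fullshift B) :
  continuous f <-> forall x (N : nat), exists M : nat, forall y : X,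
    eqon (- M%:Z) M%:Z (\val x) (\val y) -> eqon (- N%:Z) N%:Z (f x) (f y).
Proof.
split.
- move=> cf x N; have /nbhs_set_typeP [M MU] := cf x _ (nbhs_eqon (f x) N).
  by exists M => y /MU.
- move=> h x U /nbhs_fullshiftP [N NU]; have [M MN] := h x N.
  by apply/nbhs_set_typeP; exists M => y /MN /NU.
Qed.

Lemma continuous_set_typeP (B : choiceType) (Y : set (fullshift B))
    (f : X -> Y) :
  continuous f <-> continuous (fun x => \val (f x)).
Proof.
split=> [cf|].
  by move=> x; apply: (continuous_comp (cf x)); exact: initial_continuous.
move=> /continuous_fullshiftP h x U /nbhs_set_typeP [N NU].
have [M MN] := h x N.
by apply/nbhs_set_typeP; exists M => y /MN /NU.
Qed.

End ContinuityOfRestrictions.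

(** * Conjugacies as two-sided block codes *)

Definition set_pt (T : Type) (X : set T) (x : T) (Xx : X x) : X :=
  exist _ x (mem_set Xx).

Lemma set_pt_exists (T : Type) (X : set T) x : X x -> exists y : X, \val y = x.
Proof. by move=> Xx; exists (set_pt Xx). Qed.

Definition shiftn (T : Type) (k : int) (x : int -> T) : int -> T :=
  fun i => x (i + k).

Lemma shiftn_eq (T : Type) (j k : int) (x : int -> T) :
  j = k -> shiftn j x = shiftn k x.
Proof. by move=> ->. Qed.

Lemma shiftnD (T : Type) (j k : int) (x : int -> T) :
  shiftn j (shiftn k x) = shiftn (j + k) x.
Proof. by apply/funext => i; rewrite /shiftn addrA. Qed.

Lemma shiftn0 (T : Type) (x : int -> T) : shiftn 0 x = x.
Proof. by apply/funext => i; rewrite /shiftn addr0. Qed.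

Lemma shiftn_invariant (T : Type) (P : (int -> T) -> Prop) :
  (forall x, P x <-> P (shiftn 1 x)) -> forall k x, P x <-> P (shiftn k x).
Proof.
move=> P1 + x; elim/int_rect => [|n IH|n IH].
- by rewrite shiftn0.
- by rewrite IH P1 shiftnD (_ : 1 + _ = n.+1%:Z) //; lia.
- by rewrite IH (P1 (shiftn (- _.+1%:Z) x)) shiftnD (_ : 1 + _ = - n%:Z) //; lia.
Qed.

Lemma shiftE (A : choiceType) (x : fullshift A) : shift x = shiftn 1 x.
Proof. by []. Qed.

Lemma shift_space_shiftn (A : finType) (X : set (fullshift A)) :
  shift_space X -> forall k x, X x <-> X (shiftn k x).
Proof. by move=> [_ sX]; apply: shiftn_invariant. Qed.

(** A conjugacy as a relation between sequences, with one radius for both directions. Points of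
    subset types are thereby avoided, and passing to the inverse is a swap of arguments. The windows
    are half open: coordinate [i + r] is not read. *)
Record bicode (A B : finType) (r : nat) (X : set (fullshift A))
    (Y : set (fullshift B)) (C : fullshift A -> fullshift B -> Prop) : Prop :=
  Bicode {
  bicode_dom : forall x y, C x y -> X x;
  bicode_cod : forall x y, C x y -> Y y;
  bicode_total : forall x, X x -> exists y, C x y;
  bicode_onto : forall y, Y y -> exists x, C x y;
  bicode_shift : forall x y, C x y -> C (shift x) (shift y);
  bicode_fwd : forall x y x' y' i, C x y -> C x' y' ->
    eqon (i - r%:Z) (i + r%:Z) x x' -> y i = y' i;
  bicode_bwd : forall x y x' y' i, C x y -> C x' y' ->
    eqon (i - r%:Z) (i + r%:Z) y y' -> x i = x' i }.

Lemma bicode_sym (A B : finType) r (X : set (fullshift A))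
    (Y : set (fullshift B)) C :
  bicode r X Y C -> bicode r Y X (fun y x => C x y).
Proof.
case=> *; split; eauto.
Qed.

Section Bicode.
Variables (A B : finType) (r : nat) (X : set (fullshift A)).
Variables (Y : set (fullshift B)) (C : fullshift A -> fullshift B -> Prop).
Hypothesis bC : bicode r X Y C.

Lemma bicode_eqon_fwd a b x y x' y' : C x y -> C x' y' ->
  eqon (a - r%:Z) (b + r%:Z) x x' -> eqon a b y y'.
Proof.
move=> xy xy' h i ai ib; apply: (bicode_fwd bC xy xy').
by apply: eqon_sub h; lia.
Qed.

Lemma bicode_fun x y y' : C x y -> C x y' -> y = y'.
Proof. by move=> xy xy'; apply/funext => i; exact: (bicode_fwd bC xy xy'). Qed.

End Bicode.

Section ConjugacyOfBicode.
Variables (A B : finType) (r : nat) (X : set (fullshift A)).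
Variables (Y : set (fullshift B)) (C : fullshift A -> fullshift B -> Prop).
Hypothesis bC : bicode r X Y C.

Lemma bicode_map : exists f : X -> Y, forall x, C (\val x) (\val (f x)).
Proof.
suff /choice [f fP] : forall x : X, exists y : Y, C (\val x) (\val y).
  by exists f.
move=> x; have [y xy] := bicode_total bC (set_valP x).
by exists (set_pt (bicode_cod bC xy)).
Qed.

Lemma bicode_continuous (f : X -> Y) :
  (forall x, C (\val x) (\val (f x))) -> continuous f.
Proof.
move=> fP; apply/continuous_set_typeP/continuous_fullshiftP => x N.
exists (N + r)%N => y xy; apply: (bicode_eqon_fwd bC (fP x) (fP y)).
by apply: eqon_sub xy; lia.
Qed.

End ConjugacyOfBicode.

Lemma conjugacy_of_bicode (A B : finType) r (X : set (fullshift A))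
    (Y : set (fullshift B)) C : bicode r X Y C ->
  exists (f : X -> Y) (g : Y -> X), inverse_conjugacies f g /\
    forall x, C (\val x) (\val (f x)).
Proof.
move=> bC; have bC' := bicode_sym bC.
have [f fP] := bicode_map bC; have [g gP] := bicode_map bC'.
exists f, g; split => //; split.
- move=> x x' e; apply: (bicode_fun bC (fP x')).
  by rewrite e; apply: bicode_shift bC _ _ _.
- exact: bicode_continuous bC _ fP.
- exact: bicode_continuous bC' _ gP.
- move=> x; apply: val_inj.
  exact: (bicode_fun bC' (gP (f x)) (fP x)).
- move=> y; apply: val_inj.
  exact: (bicode_fun bC (fP (g y)) (gP y)).
Qed.

Lemma shift_commuting_shiftn (A B : finType) (X : set (fullshift A))
    (f : X -> fullshift B) : shift_space X ->
  (forall x x' : X, \val x' = shift (\val x) -> f x' = shift (f x)) ->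
  forall k (x x' : X), \val x' = shiftn k (\val x) -> f x' = shiftn k (f x).
Proof.
move=> sX sf k x x' e.
pose P k := forall x x' : X, \val x' = shiftn k (\val x) ->
  f x' = shiftn k (f x).
suff : P k by apply.
elim/int_rect: k {x x' e} => [|n IH|n IH] x x' e.
- by rewrite shiftn0 in e; rewrite shiftn0 (val_inj e).
- have Xs : X (shiftn n (\val x)).
    exact: (shift_space_shiftn sX _ _).1 (set_valP x).
  rewrite (sf (set_pt Xs) x').
    by rewrite (IH x (set_pt Xs)) // shiftE shiftnD; apply: shiftn_eq; lia.
  rewrite e /set_pt /= shiftE shiftnD.
      by apply: shiftn_eq; lia.
- have Xs : X (shiftn (- n%:Z) (\val x)).
    exact: (shift_space_shiftn sX _ _).1 (set_valP x).
  have <- : shiftn (-1) (f (set_pt Xs)) = f x'.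
    rewrite (sf x' (set_pt Xs)); last first.
      rewrite e /set_pt /= shiftE shiftnD.
      by apply: shiftn_eq; lia.
    by rewrite shiftE shiftnD -[RHS]shiftn0; apply: shiftn_eq; lia.
  by rewrite (IH x (set_pt Xs)) // shiftnD; apply: shiftn_eq; lia.
Qed.

(** The Curtis-Hedlund-Lyndon theorem. If no radius worked, there would be pairs agreeing on ever
    larger windows with different images at 0; at a cluster point continuity forces these images to
    be equal. *)
Lemma block_code (A B : finType) (X : set (fullshift A))
    (f : X -> fullshift B) : shift_space X -> continuous f ->
  (forall x x' : X, \val x' = shift (\val x) -> f x' = shift (f x)) ->
  exists r : nat, forall (x x' : X) (i : int),
    eqon (i - r%:Z) (i + r%:Z) (\val x) (\val x') -> f x i = f x' i.
Proof.
move=> sX cf sf.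
suff [r rP] : exists r : nat, forall x x' : X,
    eqon (- r%:Z) r%:Z (\val x) (\val x') -> f x 0 = f x' 0.
  exists r => x x' i xx'.
  have sh (z : X) : {z' : X | \val z' = shiftn i (\val z)}.
    have Xs : X (shiftn i (\val z)).
      exact: (shift_space_shiftn sX _ _).1 (set_valP z).
    by exists (set_pt Xs).
  have [[z zx] [z' zx']] := (sh x, sh x').
  have := rP z z'.
  rewrite (shift_commuting_shiftn sX sf zx) (shift_commuting_shiftn sX sf zx').
  rewrite /shiftn add0r; apply; rewrite zx zx' => k k1 k2.
  by apply: xx'; lia.
apply/not_existsP => nr.
have /choice [u uP] : forall r : nat, exists p : X * X,
    eqon (- r%:Z) r%:Z (\val p.1) (\val p.2) /\ f p.1 0 <> f p.2 0.
  move=> r; have /existsNP [x /existsNP [x' /not_implyP [h1 h2]]] := nr r.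
  by exists (x, x').
have [|x Xx xu] := cluster_seq sX.1 (u := fun n => \val (u n).1).
  by move=> n; exact: set_valP.
pose xx : X := set_pt Xx.
(* The output window of size 1 is [[-1, 1)], which contains coordinate 0. *)
have [M MP] := (continuous_fullshiftP f).1 cf xx 1%N.
have [n Mn xn] := xu M; have [e] := uP n; apply.
have e1 : eqon (-1) 1 (f xx) (f (u n).1) by apply: MP.
have e2 : eqon (-1) 1 (f xx) (f (u n).2).
  apply: MP; apply: eqon_trans xn _.
  by apply: eqon_sub e; lia.
by rewrite -e1 // e2.
Qed.

Lemma bicode_of_conjugacy (A B : finType) (X : set (fullshift A))
    (Y : set (fullshift B)) (f : X -> Y) (g : Y -> X) :
  shift_space X -> shift_space Y -> inverse_conjugacies f g ->
  exists r : nat, bicode r X Y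
    (fun x y => exists2 z : X, \val z = x & \val (f z) = y).
Proof.
move=> sX sY [sf cf cg fK gK].
have sg : shift_commuting g.
  move=> y y' e; have Xs : X (shift (\val (g y))).
    exact: (sX.2 _).1 (set_valP _).
  pose z : X := set_pt Xs.
  suff -> : y' = f z by rewrite fK.
  by apply: val_inj; rewrite e (sf (g y) z) // gK.
have [r rP] := block_code sX ((continuous_set_typeP f).1 cf) sf.
have [s sP] := block_code sY ((continuous_set_typeP g).1 cg) sg.
exists (maxn r s); split.
- by move=> _ _ [z <- _]; exact: set_valP.
- by move=> _ _ [z _ <-]; exact: set_valP.
- by move=> x Xx; exists (\val (f (set_pt Xx))), (set_pt Xx).
- move=> y Yy; exists (\val (g (set_pt Yy))).
  by exists (g (set_pt Yy)) => //; rewrite gK.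
- move=> _ _ [z <- <-]; have Xs : X (shift (\val z)) by exact: (sX.2 _).1 (set_valP _).
  by exists (set_pt Xs) => //; rewrite (sf z).
- move=> _ _ _ _ i [z <- <-] [z' <- <-] h; apply: rP.
  by apply: eqon_sub h; lia.
- move=> _ _ _ _ i [z <- <-] [z' <- <-] h.
  rewrite -(fK z) -(fK z'); apply: sP.
  by apply: eqon_sub h; lia.
Qed.

(** * Pasts, indecomposable and good vertices *)

Lemma count_ltn (T : eqType) (a b : pred T) (s : seq T) (x : T) :
  subpred a b -> x \in s -> b x -> ~~ a x -> (count a s < count b s)%N.
Proof.
move=> ab + bx ax; elim: s => //= z s IH.
rewrite inE => /orP [/eqP <-|/IH lt].
  by rewrite bx (negbTE ax) add0n ltnS sub_count.
by rewrite -addnS leq_add //; case: (boolP (a z)) => // /ab ->.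
Qed.

Definition splice (T : Type) (x : int -> T) (i : int) (w : int -> T) : int -> T :=
  fun k => if k < i then x k else w k.

Definition left_at (T : Type) (x : int -> T) (i : int) : ray T :=
  fun n => x (i - n.+1%:Z).

Lemma spliceL (T : Type) (x w : int -> T) (i k : int) : k < i -> splice x i w k = x k.
Proof. by rewrite /splice => ->. Qed.

Lemma spliceR (T : Type) (x w : int -> T) (i k : int) : i <= k -> splice x i w k = w k.
Proof. by rewrite /splice; case: ltP => //; lia. Qed.

Lemma eq_left_at (T : Type) (x w : int -> T) (i : int) :
  (forall k, k < i -> x k = w k) -> left_at x i = left_at w i.
Proof. by move=> h; apply/funext => n; apply: h; lia. Qed.

Lemma left_at_surj (T : Type) (y : ray T) (i : int) : exists x : int -> T, y = left_at x i.
Proof.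
exists (fun k => y `|(i - k - 1)%R|%N).
by apply/funext => n; congr (y _); lia.
Qed.

Lemma left_at_succ (T : Type) (x : int -> T) (i : int) :
  left_at x (i + 1) = ray_cons (x i) (left_at x i).
Proof. by apply/funext => -[|n]; congr (x _); lia. Qed.

Lemma ray_cons_inj (T : Type) (a b : T) (y z : ray T) :
  ray_cons a y = ray_cons b z -> a = b /\ y = z.
Proof.
move=> e; split; first exact: (congr1 (fun x : ray T => x 0%N) e).
by apply/funext => n; exact: (congr1 (fun x : ray T => x n.+1) e).
Qed.

Definition shift_inv (A : finType) (X : set (fullshift A)) : Prop :=
  forall x, X x <-> X (shift x).

(** The Krieger vertex of the right ray of [w] from [i] on, kept as a function of the whole point so
    that vertices at different positions can be compared. *)
Definition past (A : finType) (X : set (fullshift A)) (w : fullshift A)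
    (i : int) : set (ray A) :=
  Defs.pred_set X (right_ray (shiftn i w)).

Definition indec (A : finType) (X : set (fullshift A)) (S : set (ray A)) : Prop :=
  forall V : set (set (ray A)), V `<=` krieger_vertices X ->
    S = \bigcup_(T in V) T -> V S.

(* The vertices of the generalised left Fischer cover. *)
Definition good (A : finType) (X : set (fullshift A)) (S : set (ray A)) : Prop :=
  exists w i j, [/\ X w, i <= j, S = past X w i & indec X (past X w j)].

Section Past.
Variables (A : finType) (X : set (fullshift A)).
Hypothesis sX : shift_inv X.
Implicit Types (x w v : fullshift A) (S T : set (ray A)) (i j k : int).

Lemma X_shiftn k x : X x <-> X (shiftn k x).
Proof. exact: shiftn_invariant sX k x. Qed.

(** Turns membership in a past into membership of a two-sided point. The condition that the ray
    extends to the right within [X] is witnessed by the spliced point itself. *)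
Lemma past_splice x i w : past X w i (left_at x i) <-> X (splice x i w).
Proof.
rewrite /past /Defs.pred_set /=.
have -> : glue (left_at x i) (right_ray (shiftn i w)) = shiftn i (splice x i w).
  apply/funext => -[n|n]; rewrite /glue /shiftn.
    by rewrite spliceR //; lia.
  by rewrite spliceL; [congr (x _); lia | lia].
split=> [[_ Xs]|Xs]; first by apply/(X_shiftn i).
split; last exact: (X_shiftn i _).1 Xs.
exists (shiftn i (splice x i w)); first exact: (X_shiftn i _).1 Xs.
apply/funext => n; rewrite /left_ray /shiftn spliceL; last by lia.
by congr (x _); lia.
Qed.

Lemma eq_past w w' i : (forall k, i <= k -> w k = w' k) -> past X w i = past X w' i.
Proof.
move=> h; rewrite /past; congr (Defs.pred_set X _).
by apply/funext => n; apply: h; lia.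
Qed.

Lemma past_shiftn w k i : past X (shiftn k w) i = past X w (i + k).
Proof. by rewrite /past shiftnD. Qed.

Lemma past_left w i : X w -> past X w i (left_at w i).
Proof.
move=> Xw; apply/past_splice.
by rewrite (_ : splice _ _ _ = w) //; apply/funext => k; rewrite /splice; case: ifP.
Qed.

(** This is the edge relation of the Krieger cover: the source is the preimage of the target under
    appending the label. *)
Lemma pastS w i : past X w i = ray_cons (w i) @^-1` past X w (i + 1).
Proof.
apply/seteqP; split => y /=; have [x ->] := left_at_surj y i.
- move=> /past_splice Xs; have := past_left (i + 1) Xs.
  rewrite left_at_succ spliceR // (_ : left_at _ i = left_at x i); last first.
    by apply: eq_left_at => k ki; rewrite spliceL.
  rewrite (@eq_past _ w) // => k ik; rewrite spliceR //; lia.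
- have e : ray_cons (w i) (left_at x i) = left_at (splice x i w) (i + 1).
    rewrite left_at_succ spliceR //; congr ray_cons.
    by apply: eq_left_at => k ki; rewrite spliceL.
  rewrite e => /past_splice Xs; apply/past_splice.
  rewrite (_ : splice x i w = splice (splice x i w) (i + 1) w) //.
  apply/funext => k; have [ki|ik] := ltP k (i + 1); first by rewrite [RHS]spliceL.
  by rewrite [RHS]spliceR // spliceR //; lia.
Qed.

Lemma past_sub_shift w w' i j : j <= i -> (forall k, j <= k -> k < i -> w k = w' k) ->
  past X w i `<=` past X w' i -> past X w j `<=` past X w' j.
Proof.
move=> ji; have [n ->] : exists n : nat, j = i - n%:Z by exists `|(i - j)%R|%N; lia.
elim: n {j ji} => [|n IH] h ww.
  by rewrite subr0.
have e1 : i - n.+1%:Z + 1 = i - n%:Z by lia.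
rewrite pastS [X in _ `<=` X]pastS e1 -h; [|lia|lia].
by move=> y /=; apply: IH => // k k1 k2; apply: h => //; lia.
Qed.

Lemma past_eq_shift w w' i j : j <= i -> (forall k, j <= k -> k < i -> w k = w' k) ->
  past X w i = past X w' i -> past X w j = past X w' j.
Proof.
move=> ji h e; apply/seteqP; split; apply: past_sub_shift ji _ _ => //;
  rewrite ?e // => k k1 k2; by rewrite h.
Qed.

Lemma krieger_past w i : X w -> krieger_vertices X (past X w i).
Proof.
move=> Xw; exists (right_ray (shiftn i w)) => //.
by exists (shiftn i w) => //; exact: (X_shiftn _ _).1 Xw.
Qed.

Lemma kriegerP S i : krieger_vertices X S -> exists2 w, X w & S = past X w i.
Proof.
move=> [_ [w Xw <-] <-]; exists (shiftn (- i) w); first exact: (X_shiftn _ _).1 Xw.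
by rewrite /past shiftnD subrr shiftn0.
Qed.

Lemma krieger_nonempty S : krieger_vertices X S -> exists y, S y.
Proof.
by move=> /(kriegerP 0) [w Xw ->]; exists (left_at w 0); apply: past_left.
Qed.

Lemma krieger_splice S x i : krieger_vertices X S -> S (left_at x i) ->
  exists w, [/\ X w, forall k, k < i -> w k = x k & S = past X w i].
Proof.
move=> /(kriegerP i) [w Xw ->] /past_splice Xs; exists (splice x i w); split => //.
  by move=> k ki; rewrite spliceL.
by apply: eq_past => k ik; rewrite spliceR.
Qed.

Lemma krieger_pull S a y : krieger_vertices X S -> S (ray_cons a y) ->
  krieger_vertices X (ray_cons a @^-1` S).
Proof.
move=> /(kriegerP 1) [w Xw ->].
have [x ex] := left_at_surj (ray_cons a y) 1.
rewrite ex => Sy; have [w' [Xw' wx e]] := krieger_splice (krieger_past 1 Xw) Sy.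
have ax : a = w' 0.
  rewrite wx //; have := congr1 (fun r : ray A => r 0%N) ex.
  by rewrite /= /left_at => ->.
have := krieger_past 0 Xw'; by rewrite pastS add0r -e ax.
Qed.

Lemma goodP S i : good X S ->
  exists w j, [/\ X w, i <= j, S = past X w i & indec X (past X w j)].
Proof.
move=> [w [i' [j [Xw ij -> idj]]]].
exists (shiftn (i' - i) w), (j - i' + i); split; first exact: (X_shiftn _ _).1 Xw.
- by lia.
- by rewrite past_shiftn; congr past; lia.
- by rewrite past_shiftn (_ : _ + (i' - i) = j) //; lia.
Qed.

Lemma good_krieger S : good X S -> krieger_vertices X S.
Proof. by move=> [w [i [j [Xw _ -> _]]]]; apply: krieger_past. Qed.

Lemma indec_good w i : X w -> indec X (past X w i) -> good X (past X w i).
Proof. by move=> Xw idw; exists w, i, i. Qed.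

(** The future of [w] from [j] on may be exchanged for one that meets an indecomposable past: the
    past at [i] depends only on the past at [j] and the letters in between. *)
Lemma good_past w i j : X w -> i <= j -> good X (past X w j) -> good X (past X w i).
Proof.
move=> Xw ij /(goodP j) [v [m [Xv jm e idm]]].
exists (splice w j v), i, m; split.
- by apply/past_splice; rewrite -e; apply: past_left.
- by lia.
- apply: (@past_eq_shift _ _ j) => // [k k1 k2|]; first by rewrite spliceL.
  by rewrite e; apply: eq_past => k jk; rewrite spliceR.
- by rewrite (@eq_past _ v) // => k mk; rewrite spliceR //; lia.
Qed.

Lemma good_pull S a y : good X S -> S (ray_cons a y) ->
  good X (ray_cons a @^-1` S).
Proof.
move=> gS; have [x ex] := left_at_surj (ray_cons a y) 1.
rewrite ex => Sy.
have [w [Xw wx e]] := krieger_splice (good_krieger gS) Sy.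
have ax : a = w 0.
  rewrite wx //; have := congr1 (fun r : ray A => r 0%N) ex.
  by rewrite /= /left_at => ->.
have := pastS w 0; rewrite add0r -e -ax => <-.
by apply: (@good_past _ _ 1) => //; rewrite -e.
Qed.

Hypothesis fK : finite_set (krieger_vertices X).

(* A minimal vertex containing [y] is indecomposable. *)
Lemma indec_below S y : krieger_vertices X S -> S y ->
  exists T, [/\ krieger_vertices X T, indec X T, T y & T `<=` S].
Proof.
move=> KS Sy.
have [s sE] : exists s : seq (set (ray A)), [set` s] = krieger_vertices X.
  by move/finite_seqP: fK => [s ->]; exists s.
(* Inclusion is measured by the number of listed vertices contained in [T]; a least value gives a
   vertex minimal among those containing [y]. *)
pose Q (n : nat) := exists T, [/\ krieger_vertices X T, T y, T `<=` S &
  (count (fun U => `[< U `<=` T >]) s = n)%N].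
have exQ : exists n, `[< Q n >].
  by eexists; apply/asboolP; exists S; split.
case: (ex_minnP exQ) => n /asboolP [T [KT Ty TS nT]] nmin.
exists T; split => // V VK TV.
have [U VU Uy] : (\bigcup_(U in V) U) y by rewrite -TV.
have UT : U `<=` T by rewrite TV => z Uz; exists U.
suff TU : T `<=` U by rewrite (_ : T = U) //; apply/seteqP.
apply: contrapT => nTU.
have : `[< Q (count (fun W => `[< W `<=` U >]) s) >].
  apply/asboolP; exists U; split => //; first exact: VK.
  exact: subset_trans TS.
move=> /nmin; rewrite -nT leqNgt => /negP; apply.
apply: (@count_ltn _ _ _ _ T).
- by move=> W /asboolP WU; apply/asboolP; apply: subset_trans UT.
- by have : [set` s] T by rewrite sE.
- exact/asboolP.
- exact/asboolP.
Qed.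

End Past.

(** * Transport of pasts along a conjugacy *)

Section HalfLines.
Variables (A B : finType) (r : nat) (X : set (fullshift A)).
Variables (Y : set (fullshift B)) (C : fullshift A -> fullshift B -> Prop).
Hypothesis bC : bicode r X Y C.

Lemma bicode_right (i : int) w v w' v' : C w v -> C w' v' ->
  (forall k, i <= k -> w k = w' k) -> forall k, i + r%:Z <= k -> v k = v' k.
Proof.
by move=> c c' h k ik; apply: (bicode_fwd bC c c') => j kj _; apply: h; lia.
Qed.

Lemma bicode_left (i : int) w v w' v' : C w v -> C w' v' ->
  (forall k, k < i -> w k = w' k) -> forall k, k < i - r%:Z -> v k = v' k.
Proof.
by move=> c c' h k ik; apply: (bicode_fwd bC c c') => j _ kj; apply: h; lia.
Qed.

End HalfLines.

Section PastTransport.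
Variables (A B : finType) (r : nat) (X : set (fullshift A)).
Variables (Y : set (fullshift B)) (C : fullshift A -> fullshift B -> Prop).
Hypotheses (sX : shift_inv X) (sY : shift_inv Y) (bC : bicode r X Y C).

(** Let [u] be the preimage of [x] glued to [v] at [i]. It equals [w] from [i + r] on, so its part
    left of [n] can be continued by [w'], and the image [z] of the result turns out to be [x] glued
    to [v']. Indeed [z] agrees with [v'] from [i + 2 r] on (one radius for [u], one for [z]) and
    with the image of [u] left of [n - r]; these ranges meet for [n = i + 3 r]. On [[i, i + 2 r)]
    the points [v] and [v'] agree because [w] and [w'] do nearby. *)
Lemma past_transport (i : int) w v w' v' : C w v -> C w' v' ->
  eqon (i - r%:Z) (i + 3%:Z * r%:Z) w w' ->
  past X w (i + 3%:Z * r%:Z) `<=` past X w' (i + 3%:Z * r%:Z) ->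
  past Y v i `<=` past Y v' i.
Proof.
set n := i + 3%:Z * r%:Z => c c' ww sub y.
have [x ->] := left_at_surj y i => /(past_splice sY) Yu.
have [u Cu] := bicode_onto bC Yu.
have uw k : i + r%:Z <= k -> u k = w k.
  apply: (bicode_right (bicode_sym bC) Cu c) => j ij.
  by rewrite spliceR.
have Xs : X (splice u n w').
  apply/(past_splice sX)/sub; rewrite (@eq_past _ _ w u) => [|k nk].
    exact: (past_left sX _ (bicode_dom bC Cu)).
  by rewrite uw //; rewrite /n in nk; lia.
have [z Cz] := bicode_total bC Xs.
apply/(past_splice sY); rewrite (_ : splice _ _ _ = z); first exact: (bicode_cod bC Cz).
apply/funext => k; have [ki|ik] := ltP k i.
  rewrite spliceL // -(@spliceL _ x v i) //.
  apply: (bicode_left bC (i := n) Cu Cz); last by rewrite /n; lia.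
  by move=> j jn; rewrite spliceL.
rewrite spliceR //; have [kn|nk] := ltP k (i + 2%:Z * r%:Z).
  rewrite -(bicode_fwd bC c c') => [|j kj jk]; last by apply: ww; rewrite /n; lia.
  rewrite -[LHS](@spliceR _ x v i) //.
  apply: (bicode_left bC (i := n) Cu Cz); last by rewrite /n; lia.
  by move=> j jn; rewrite spliceL.
apply: (bicode_right bC (i := i + r%:Z) c' Cz); last by lia.
move=> j ij; have [jn|nj] := ltP j n; last by rewrite spliceR.
by rewrite spliceL // uw // ww //; lia.
Qed.

Lemma past_transport_eq (i : int) w v w' v' : C w v -> C w' v' ->
  eqon (i - r%:Z) (i + 3%:Z * r%:Z) w w' ->
  past X w (i + 3%:Z * r%:Z) = past X w' (i + 3%:Z * r%:Z) ->
  past Y v i = past Y v' i.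
Proof.
move=> c c' ww e; apply/seteqP; split.
  by apply: (past_transport c c' ww); rewrite e.
by apply: (past_transport c' c (eqon_sym ww)); rewrite e.
Qed.

End PastTransport.

Lemma indec_transport (A B : finType) (r : nat) (X : set (fullshift A))
    (Y : set (fullshift B)) (C : fullshift A -> fullshift B -> Prop)
    (i : int) w v :
  shift_inv X -> shift_inv Y -> finite_set (krieger_vertices Y) ->
  bicode r X Y C -> C w v ->
  indec X (past X w (i + 3%:Z * r%:Z)) -> good Y (past Y v i).
Proof.
move=> sX sY fY bC c; set n := i + 3%:Z * r%:Z => idw.
have bC' := bicode_sym bC.
(* The constant is [2 r + 3 r]: the image of a modified past agrees with [v] from [n + r] on, hence
   on the windows needed to compare pasts at [n + 2 r], and that comparison reaches [3 r]
   further. *)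
pose m := n + 5%:Z * r%:Z.
(* Decompose the past of [v] at [m] into indecomposable vertices and pull the
   pieces back along the inverse code: their pasts at [n] cover that of [w]. *)
pose V := [set T | exists p q, [/\ C p q, T = past X p n, T `<=` past X w n &
  indec Y (past Y q m)]].
have [||p [q [cpq e _ idq]]] := idw V.
- by move=> _ [p [q [cpq -> _ _]]]; apply: krieger_past sX _ _ (bicode_dom bC cpq).
- apply/seteqP; split; last by move=> y [T [p [q [_ _ h _]]] Ty]; apply: h.
  move=> y; have [u0 ->] := left_at_surj y n => /(past_splice sX) Xu.
  have [u Cu] := bicode_total bC Xu.
  have uv k : n + r%:Z <= k -> u k = v k.
    apply: (bicode_right bC Cu c) => j nj.
    by rewrite spliceR.
  have vm : past Y v m (left_at u m).
    rewrite (@eq_past _ _ v u) => [|k mk]; first exact: (past_left sY _ (bicode_cod bC Cu)).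
    by rewrite uv //; rewrite /m in mk; lia.
  have [Q [KQ idQ Qu QT]] := indec_below fY (krieger_past sY m (bicode_cod bC c)) vm.
  have [q [Yq qu eQ]] := krieger_splice sY KQ Qu.
  have [p cpq] := bicode_onto bC Yq.
  have pu k : k < n + 4%:Z * r%:Z -> p k = splice u0 n w k.
    move=> kn; apply: (bicode_left bC' (i := m) cpq Cu) => //.
    by rewrite /m; lia.
  exists (past X p n).
    exists p, q; split => //; last by rewrite -eQ.
    apply: (past_sub_shift sX (i := n + 2%:Z * r%:Z)); first by lia.
      by move=> k nk kn; rewrite pu ?spliceR //; lia.
    apply: (past_transport sY sX bC' cpq c).
      move=> k k1 k2; rewrite qu; last by rewrite /m; lia.
      by rewrite uv //; lia.
    by rewrite (_ : n + 2%:Z * r%:Z + 3%:Z * r%:Z = m); [rewrite -eQ | rewrite /m; lia].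
  rewrite (_ : left_at u0 n = left_at p n); first exact: (past_left sX _ (bicode_dom bC cpq)).
  by apply: eq_left_at => k kn; rewrite pu ?spliceL //; lia.
(* The piece equal to the past of [w] provides a continuation [p] of [w] beyond [n]. The image [z]
   of the spliced point has the same past as [v] at [i] and an indecomposable past at [m]. *)
- rewrite -/m in idq.
  have Xs : X (splice w n p).
    by apply/(past_splice sX); rewrite -e; apply: (past_left sX _ (bicode_dom bC c)).
  have [z Cz] := bicode_total bC Xs.
  exists z, i, m; split; first exact: (bicode_cod bC Cz).
  + by rewrite /m /n; lia.
  + apply: (past_transport_eq sX sY bC c Cz) => [k k1 k2|].
      by rewrite spliceL.
    by rewrite e; apply: eq_past => k nk; rewrite spliceR.
  + rewrite (@eq_past _ _ z q) // => k mk.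
    apply: (bicode_right bC (i := n) Cz cpq).
      by move=> j nj; rewrite spliceR.
    by rewrite /m in mk; lia.
Qed.

(** * Points of the cover and their lifts *)

(* A point of the generalised left Fischer cover as its label sequence [x] and
   its vertices [P]. *)
Definition cpoint (A : finType) (X : set (fullshift A)) (x : fullshift A)
    (P : int -> set (ray A)) : Prop :=
  forall i, good X (P i) /\ P i = ray_cons (x i) @^-1` P (i + 1).

Lemma cpoint_left (A : finType) (X : set (fullshift A)) x P i j z :
  cpoint X x P -> j <= i -> (forall k, j <= k -> k < i -> z k = x k) ->
  P j (left_at z j) <-> P i (left_at z i).
Proof.
move=> cP; move=> ji; have [n ->] : exists n : nat, j = i - n%:Z.
  by exists `|(i - j)%R|%N; lia.
elim: n {j ji} => [|n IH] h; first by rewrite subr0.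
have e1 : i - n.+1%:Z + 1 = i - n%:Z by lia.
rewrite -IH => [|k k1 k2]; last by apply: h; lia.
rewrite (cP _).2 e1 /= -h; [|lia|lia].
by rewrite -left_at_succ e1.
Qed.

Lemma cpoint_eq (A : finType) (X : set (fullshift A)) x P x' P' i j :
  cpoint X x P -> cpoint X x' P' -> j <= i ->
  (forall k, j <= k -> k < i -> x k = x' k) -> P i = P' i -> P j = P' j.
Proof.
move=> cP cP' ji h e; apply/seteqP; split => y.
  have [u ->] := left_at_surj y j; pose z := splice u j x.
  have -> : left_at u j = left_at z j by apply: eq_left_at => k kj; rewrite /z spliceL.
  rewrite (cpoint_left (z := z) cP ji) => [|k jk _]; last by rewrite /z spliceR.
  by rewrite e -(cpoint_left cP' ji) // => k jk ki; rewrite /z spliceR // h.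
have [u ->] := left_at_surj y j; pose z := splice u j x.
have -> : left_at u j = left_at z j by apply: eq_left_at => k kj; rewrite /z spliceL.
rewrite (cpoint_left (z := z) cP' ji) => [|k jk ki]; last by rewrite /z spliceR // h.
by rewrite -e -(cpoint_left cP ji) // => k jk ki; rewrite /z spliceR.
Qed.

(** One witness at [i] represents all vertices further left, since [P] and the pasts of [w] obey the
    same recursion along the same labels. *)
Lemma cpoint_past (A : finType) (X : set (fullshift A)) x P w i j :
  shift_inv X -> cpoint X x P -> j <= i -> (forall k, k < i -> w k = x k) ->
  P i = past X w i -> P j = past X w j.
Proof.
move=> sX cP ji wx e; apply/seteqP; split => y; have [u ->] := left_at_surj y j;
  pose z := splice u j x;
  rewrite (_ : left_at u j = left_at z j); try by apply: eq_left_at => k kj; rewrite /z spliceL.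
- rewrite (cpoint_left (z := z) cP ji) => [|k jk _]; last by rewrite /z spliceR.
  rewrite e => /(past_splice sX) Xs; apply/(past_splice sX).
  rewrite (_ : splice z j w = splice z i w) //; apply/funext => k.
  have [kj|jk] := ltP k j; first by rewrite !spliceL //; lia.
  rewrite spliceR //; have [ki|ik] := ltP k i; last by rewrite spliceR.
  by rewrite spliceL // /z spliceR // wx.
- move=> /(past_splice sX) Xs.
  rewrite (cpoint_left (z := z) cP ji) => [|k jk _]; last by rewrite /z spliceR.
  rewrite e; apply/(past_splice sX).
  rewrite (_ : splice z i w = splice z j w) //; apply/funext => k.
  have [kj|jk] := ltP k j; first by rewrite !spliceL //; lia.
  rewrite [RHS]spliceR //; have [ki|ik] := ltP k i; last by rewrite spliceR.
  by rewrite spliceL // /z spliceR // wx.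
Qed.

(** Write [S] as the preimage of the next past and cut that past into indecomposable vertices. Their
    preimages cover [S], so one of them is [S]. *)
Lemma indec_succ (A : finType) (X : set (fullshift A)) (S : set (ray A)) :
  shift_inv X -> finite_set (krieger_vertices X) ->
  krieger_vertices X S -> indec X S -> exists a T,
  [/\ krieger_vertices X T, indec X T & S = ray_cons a @^-1` T].
Proof.
move=> sX fK KS idS.
have [w Xw eS] := kriegerP sX 0 KS.
have eS1 : S = ray_cons (w 0) @^-1` past X w 1 by rewrite eS (pastS sX) add0r.
(* Empty preimages are excluded: only nonempty ones are vertices. *)
pose V := [set U | exists T, [/\ krieger_vertices X T, indec X T,
  T `<=` past X w 1, U = ray_cons (w 0) @^-1` T & exists y, U y]].
have [||T [KT idT _ e _]] := idS V; last by exists (w 0), T.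
- by move=> _ [T [KT _ _ -> [y Uy]]]; apply: (krieger_pull sX KT Uy).
- apply/seteqP; split=> [y Sy|y [_ [T [_ _ sT -> _]] Ty]]; last first.
    by rewrite eS1; apply: sT.
  have Py : past X w 1 (ray_cons (w 0) y) by move: Sy; rewrite eS1.
  have [T [KT idT Ty sT]] := indec_below fK (krieger_past sX 1 Xw) Py.
  by exists (ray_cons (w 0) @^-1` T) => //; exists T; split => //; exists y.
Qed.

Section CoverPoints.
Variables (A : finType) (X : set (fullshift A)).
Hypothesis ssX : shift_space X.
Implicit Types (x w : fullshift A) (P : int -> set (ray A)) (S : set (ray A)).

(** The recursion alone only transfers membership between positions. Here closedness enters: some
    left ray of [P j], continued by the labels from [j] to [i], lies in [P i], and the resulting
    points converge as [j] decreases. *)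
Lemma cpoint_left_at x P i : cpoint X x P -> P i (left_at x i).
Proof.
have [cX sX] := ssX => cP.
have [w Xw ew] := kriegerP sX i (good_krieger sX (cP i).1).
rewrite ew; apply/(past_splice sX).
apply: ((closed_eqonP X).1 cX) => M.
pose j := Order.min (- M%:Z) i; have ji : j <= i by rewrite /j; lia.
have [y Pjy] := krieger_nonempty sX (good_krieger sX (cP j).1).
have [v ev] := left_at_surj y j; pose z := splice v j x.
have zx k : j <= k -> z k = x k by move=> jk; rewrite /z spliceR.
have : P i (left_at z i).
  apply/(cpoint_left cP ji) => [k jk _|]; first exact: zx.
  rewrite (_ : left_at z j = y) // ev.
  by apply: eq_left_at => k kj; rewrite /z spliceL.
rewrite ew => /(past_splice sX) Xs; exists (splice z i w) => // k Mk _.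
have [ki|ik] := ltP k i; last by rewrite !spliceR.
by rewrite !spliceL // zx //; rewrite /j; lia.
Qed.

Lemma cpoint_rep x P i : cpoint X x P -> exists w j,
  [/\ X w, (forall k, k < i -> w k = x k), P i = past X w i, i <= j &
  indec X (past X w j)].
Proof.
have [cX sX] := ssX => cP.
have [w [j [Xw ij e idj]]] := goodP sX i (cP i).1.
have Pi := cpoint_left_at i cP.
exists (splice x i w), j; split => //.
- by apply/(past_splice sX); rewrite -e.
- by move=> k ki; rewrite spliceL.
- by rewrite e; apply: eq_past => k ik; rewrite spliceR.
- by rewrite (@eq_past _ _ _ w) // => k jk; rewrite spliceR //; lia.
Qed.

Lemma cpoint_label x P : cpoint X x P -> X x.
Proof.
have [cX sX] := ssX => cP; apply: ((closed_eqonP X).1 cX) => M.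
have [w [_ [Xw wx _ _ _]]] := cpoint_rep M%:Z cP.
by exists w => // k _ kM; rewrite wx.
Qed.

Hypothesis fK : finite_set (krieger_vertices X).

(** Up to the position [j] of an indecomposable past the vertices are the pasts of one point. Beyond
    [j] the pasts of that point might fail to be good, so [indec_succ] is iterated instead, which
    keeps all later vertices indecomposable. *)
Lemma cpoint_extend S x i : good X S -> S (left_at x i) ->
  exists x' P, [/\ cpoint X x' P, P i = S & forall k, k < i -> x' k = x k].
Proof.
have sX := ssX.2 => gS Sx.
have [w0 [j [Xw0 ij e0 idj0]]] := goodP sX i gS.
pose w := splice x i w0.
have Xw : X w by apply/(past_splice sX); rewrite -e0.
have ew k : i <= k -> past X w k = past X w0 k.
  by move=> ik; apply: eq_past => l kl; rewrite /w spliceR //; lia.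
have idj : indec X (past X w j) by rewrite ew.
pose KI S := krieger_vertices X S /\ indec X S.
have /choice [nxt nxtP] : forall S, exists p : A * set (ray A),
    KI S -> KI p.2 /\ S = ray_cons p.1 @^-1` p.2.
  move=> U; have [KIU|nKI] := pselect (KI U); last by exists (w 0, U).
  by have [a [T [KT idT e]]] := indec_succ sX fK KIU.1 KIU.2; exists (a, T).
pose T n := iter n (fun U => (nxt U).2) (past X w j).
have KT n : KI (T n).
  elim: n => [|n IH]; first by split => //; exact: (krieger_past sX j Xw).
  exact: (nxtP _ IH).1.
pose P k := if k < j then past X w k else T `|(k - j)%R|%N.
pose x' : fullshift A := fun k => if k < j then w k else (nxt (T `|(k - j)%R|%N)).1.
have T0 : T 0%N = past X w j by [].
exists x', P; split.
- move=> k; rewrite /P /x'; have [kj|jk] := ltP k j; last first.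
    have -> : k + 1 < j = false by lia.
    have [KIk e] := nxtP _ (KT `|(k - j)%R|%N); split; last first.
      rewrite (_ : `|(k + 1 - j)%R|%N = (`|(k - j)%R|%N).+1); last by lia.
      exact: e.
    have [K1 I1] := KT `|(k - j)%R|%N; have [v Xv ev] := kriegerP sX 0 K1.
    by rewrite ev; apply: indec_good => //; rewrite -ev.
  split; first by apply: (@good_past _ _ sX _ _ j) => //; [exact: ltW | exact: indec_good].
  rewrite (pastS sX); have [//|jk1] := ltP (k + 1) j.
  have -> : k + 1 = j by lia.
  by rewrite subrr.
- rewrite /P e0 -ew //; have [//|ji] := ltP i j.
  have -> : i = j by lia.
  by rewrite subrr.
- move=> k ki; rewrite /x' (_ : k < j = true); last by lia.
  by rewrite /w spliceL.
Qed.

End CoverPoints.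

(** At each position a related pair of points represents both vertices simultaneously. The condition
    is symmetric, so the lift of the inverse conjugacy is the same relation read backwards. *)
Definition lift (A B : finType) (X : set (fullshift A)) (Y : set (fullshift B))
    (C : fullshift A -> fullshift B -> Prop) x P y Q : Prop :=
  C x y /\ forall i, exists w v, [/\ C w v, forall k, k < i -> w k = x k,
    forall k, k < i -> v k = y k, P i = past X w i & Q i = past Y v i].

Lemma lift_sym (A B : finType) (X : set (fullshift A)) (Y : set (fullshift B))
    C x P y Q : lift X Y C x P y Q -> lift Y X (fun v w => C w v) y Q x P.
Proof. by move=> [c h]; split => // i; have [w [v []]] := h i; exists v, w. Qed.

Section Lift.
Variables (A B : finType) (r : nat) (X : set (fullshift A)).
Variables (Y : set (fullshift B)) (C : fullshift A -> fullshift B -> Prop).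
Hypotheses (ssX : shift_space X) (ssY : shift_space Y) (bC : bicode r X Y C).

Lemma lift_local x P y Q x' P' y' Q' i :
  cpoint X x P -> cpoint X x' P' -> cpoint Y y Q -> cpoint Y y' Q' ->
  lift X Y C x P y Q -> lift X Y C x' P' y' Q' ->
  eqon (i - r%:Z) (i + 3%:Z * r%:Z) x x' ->
  P (i + 3%:Z * r%:Z) = P' (i + 3%:Z * r%:Z) -> Q i = Q' i.
Proof.
set n := i + 3%:Z * r%:Z => cP cP' cQ cQ' [_ l] [_ l'] xx' e.
have [w [v [c wx vy ew ev]]] := l n; have [w' [v' [c' wx' vy' ew' ev']]] := l' n.
have i_n : i <= n by rewrite /n; lia.
rewrite (cpoint_past ssY.2 cQ i_n vy ev) (cpoint_past ssY.2 cQ' i_n vy' ev').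
apply: (past_transport_eq ssX.2 ssY.2 bC c c'); last by rewrite -/n -ew -ew'.
by move=> k k1 k2; rewrite wx // wx' // xx'.
Qed.

Hypothesis fY : finite_set (krieger_vertices Y).

(** The vertex [Q i] is the past at [i] of the image of a witness for [P] at [i + 3 r]. Its goodness
    is that of the position [3 r] before the indecomposable past of the witness, pulled left to [i].
    Witnesses for [i] and [i + 1] fit together by [past_transport_eq]. *)
Lemma lift_total x P : cpoint X x P ->
  exists y Q, cpoint Y y Q /\ lift X Y C x P y Q.
Proof.
have [sX sY] := (ssX.2, ssY.2) => cP.
have [y c] := bicode_total bC (cpoint_label ssX cP).
pose n (i : int) := i + 3%:Z * r%:Z.
have /choice [W /choice [V WV]] : forall i, exists w v, [/\ C w v,
    forall k, k < n i -> w k = x k, P (n i) = past X w (n i) &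
    good Y (past Y v i)].
  move=> i; have [w [j [Xw wx e ij idj]]] := cpoint_rep ssX (n i) cP.
  have [v cv] := bicode_total bC Xw; exists w, v; split => //.
  pose j' := j - 3%:Z * r%:Z.
  apply: (@good_past _ _ sY _ _ j').
  - exact: (bicode_cod bC cv).
  - by rewrite /j'; rewrite /n in ij; lia.
  - by apply: (indec_transport sX sY fY bC cv); rewrite (_ : _ + _ = j) // /j'; lia.
have Vy i k : k < i -> V i k = y k.
  have [cv wx _ _] := WV i => ki.
  apply: (bicode_left bC (i := n i) cv c wx); rewrite /n; lia.
exists y, (fun i => past Y (V i) i); split; last first.
  split => // i; have [cv wx e _] := WV i; exists (W i), (V i); split => //.
  - by move=> k ki; apply: wx; rewrite /n; lia.
  - exact: Vy.
  - by apply: (cpoint_past sX cP _ wx e); rewrite /n; lia.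
move=> i; have [cv wx e gi] := WV i; split => //.
have [cv1 wx1 e1 _] := WV (i + 1).
rewrite -(Vy (i + 1)); last by lia.
rewrite -(pastS sY); apply: (past_transport_eq sX sY bC cv cv1).
  by move=> k _ k2; rewrite wx // wx1 // /n; lia.
rewrite -/(n i) -e; apply: (cpoint_past sX cP _ wx1 e1); rewrite /n; lia.
Qed.

End Lift.

(** * Edges of the generalised left Fischer cover *)

Lemma pred_set_cons (A : finType) (X : set (fullshift A)) (a : A) (x : ray A) :
  shift_inv X ->
  Defs.pred_set X (ray_cons a x) = ray_cons a @^-1` Defs.pred_set X x.
Proof.
move=> sX; pose w : fullshift A :=
  fun i => match i with Posz n => ray_cons a x n | Negz _ => a end.
have e0 : Defs.pred_set X (ray_cons a x) = past X w 0.
  by rewrite /past shiftn0; congr Defs.pred_set; apply/funext => n.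
have e1 : Defs.pred_set X x = past X w 1.
  rewrite /past; congr Defs.pred_set; apply/funext => n.
  by rewrite /right_ray /shiftn -PoszD addn1.
by rewrite e0 e1 (pastS sX) add0r.
Qed.

Section Vertices.
Variables (A : finType) (X : set (fullshift A)).
Hypothesis sX : shift_inv X.
Local Notation K := (krieger_cover X).

Lemma krieger_edgeP (P Q : vertex K) (a : A) :
  (P, a, Q) \in krieger_edges X <-> \val P = ray_cons a @^-1` \val Q.
Proof.
split=> [/set_mem [x [_ /= -> ->]]|e]; first exact: pred_set_cons.
apply/mem_set; have [x Xx ex] := set_valP Q.
exists x; split => /=; [by []| |by rewrite ex].
by rewrite e pred_set_cons // ex.
Qed.

Lemma krieger_step (P Q : vertex K) (a : A) :
  \val P = ray_cons a @^-1` \val Q -> exists e : edge K, src e = P /\ tgt e = Q.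
Proof. by move=> /krieger_edgeP h; exists (exist _ (P, a, Q) h). Qed.

Lemma indecomposableP (P : vertex K) : indecomposable P <-> indec X (\val P).
Proof.
split=> idP V.
- move=> VK e; have := idP (fun Q => V (\val Q)).
  apply; rewrite e; apply/seteqP; split=> [y [T VT Ty]|y [Q VQ Qy]].
    by exists (set_pt (VK _ VT)).
  by exists (\val Q).
- move=> e; have [||Q VQ /val_inj <- //] := idP (fun T => exists2 Q, V Q & \val Q = T).
  + by move=> _ [Q _ <-]; exact: set_valP.
  + rewrite e; apply/seteqP; split=> [y [Q VQ Qy]|y [_ [Q VQ <-] Qy]].
      by exists (\val Q) => //; exists Q.
    by exists Q.
Qed.

Lemma reaches_good (P Q : vertex K) :
  reaches P Q -> good X (\val Q) -> good X (\val P).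
Proof.
elim=> [{}P {}Q [[[[P' a] Q'] h] [/= <- <-]]|//|P1 P2 P3 _ IH1 _ IH2 /IH2 /IH1 //].
have /krieger_edgeP e := h => gQ.
have [y Py] := krieger_nonempty sX (set_valP P').
have Qy : (ray_cons a @^-1` \val Q') y by rewrite -e.
by rewrite /= e; apply: good_pull sX _ _ _ gQ Qy.
Qed.

Lemma past_reaches w i (n : nat) (P Q : vertex K) : X w ->
  \val P = past X w i -> \val Q = past X w (i + n%:Z) -> reaches P Q.
Proof.
move=> Xw; elim: n i P => [|n IH] i P eP eQ.
  rewrite addr0 in eQ.
  by rewrite (_ : P = Q); [exact: rt_refl | apply: val_inj; rewrite eP eQ].
pose P1 : vertex K := set_pt (krieger_past sX (i + 1) Xw).
apply: (@rt_trans _ _ _ P1).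
  by apply: rt_step; apply: (@krieger_step _ _ (w i)); rewrite eP (pastS sX).
apply: (IH (i + 1)) => //.
by rewrite eQ; congr past; lia.
Qed.

Lemma good_reaches (P : vertex K) :
  good X (\val P) <-> exists Q, indecomposable Q /\ reaches P Q.
Proof.
split=> [[w [i [j [Xw ij eP idj]]]]|[Q [/indecomposableP idQ PQ]]]; last first.
  apply: reaches_good PQ _; have [v Xv ev] := kriegerP sX 0 (set_valP Q).
  have {}ev : \val Q = past X v 0 by rewrite -ev.
  by rewrite ev; apply: indec_good => //; rewrite -ev.
pose Q : vertex K := set_pt (krieger_past sX j Xw).
exists Q; split; first exact/indecomposableP.
apply: (@past_reaches w i `|(j - i)%R|%N) => //=.
by congr past; lia.
Qed.

End Vertices.

(** Stated from finiteness of the vertex set, which is the form available for a symbol expansion. *)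
Lemma finite_gen_fischer_cover (A : finType) (X : set (fullshift A)) :
  finite_set (krieger_vertices X) -> finite_graph (gen_fischer_cover X).
Proof.
move=> fK; have fv : finite_set [set: vertex (krieger_cover X)].
  by rewrite (eq_finite_set (card_setT _)).
have fe : finite_set [set: edge (krieger_cover X)].
  rewrite (eq_finite_set (card_setT _)).
  apply: (@sub_finite_set _ _ (([set: vertex (krieger_cover X)] `*` [set: A])
    `*` [set: vertex (krieger_cover X)])) => //.
  by apply: finite_setX => //; apply: finite_setX.
by split; rewrite (eq_finite_set (card_setT _));
  [apply: sub_finite_set fv|apply: sub_finite_set fe].
Qed.

Lemma sofic_finite_krieger (A : finType) (X : set (fullshift A)) :
  sofic X -> finite_set (krieger_vertices X).
Proof.
by move=> /finite_krieger_vertices; rewrite (eq_finite_set (card_setT _)).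
Qed.

Notation gf_edge X := (edge_alphabet (gen_fischer_cover X)).

Section Edges.
Variables (A : finType) (X : set (fullshift A)).

Definition esrc (e : gf_edge X) : set (ray A) := \val (\val (src (\val e))).
Definition etgt (e : gf_edge X) : set (ray A) := \val (\val (tgt (\val e))).
Definition elab (e : gf_edge X) : A := label (\val e).

Lemma label_mapE (e : edge_shift (gen_fischer_cover X)) :
  label_map e = (fun i => elab (\val e i)).
Proof. unfold label_map, elab. reflexivity. Qed.

Lemma edge_inj e f : esrc e = esrc f -> elab e = elab f -> etgt e = etgt f -> e = f.
Proof.
rewrite /esrc /elab /etgt => h1 h2 h3; apply/val_inj/val_inj/val_inj.
move: h1 h2 h3; rewrite /=.
case: (\val (\val (\val e))) (\val (\val (\val f))) => [[P a] Q] [[P' a'] Q'] /=.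
by move=> /val_inj -> -> /val_inj ->.
Qed.

Lemma edge_shiftP (e : fullshift (gf_edge X)) :
  edge_shift (gen_fischer_cover X) e <-> forall i, etgt (e i) = esrc (e (i + 1)).
Proof.
split=> h i; first by rewrite /etgt h.
by apply/val_inj/val_inj/h.
Qed.

Lemma edge_shift_inv : shift_inv (edge_shift (gen_fischer_cover X)).
Proof.
move=> e; rewrite !edge_shiftP; split=> h i; first exact: h.
by have := h (i - 1); rewrite /shift subrK.
Qed.

Hypothesis sX : shift_inv X.

Lemma esrcE e : esrc e = ray_cons (elab e) @^-1` etgt e.
Proof.
rewrite /esrc /elab /etgt /=.
case: (\val (\val e)) => [[[P a] Q] h] /=.
by have /(krieger_edgeP sX) := h.
Qed.

Lemma esrc_good e : good X (esrc e).
Proof. exact/(good_reaches sX)/(set_valP (src (\val e))). Qed.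

Lemma etgt_good e : good X (etgt e).
Proof. exact/(good_reaches sX)/(set_valP (tgt (\val e))). Qed.

Hypothesis fK : finite_set (krieger_vertices X).

Lemma edge_exists (S T : set (ray A)) a : good X S -> good X T ->
  S = ray_cons a @^-1` T -> exists e, [/\ esrc e = S, elab e = a & etgt e = T].
Proof.
move=> gS gT e.
pose P : vertex (krieger_cover X) := set_pt (good_krieger sX gS).
pose Q : vertex (krieger_cover X) := set_pt (good_krieger sX gT).
have PQ : (P, a, Q) \in krieger_edges X by apply/(krieger_edgeP sX).
pose k : edge (krieger_cover X) := exist _ (P, a, Q) PQ.
have kW : k \in [set k : edge (krieger_cover X) |
    (exists Q, indecomposable Q /\ reaches (src k) Q) /\
    (exists Q, indecomposable Q /\ reaches (tgt k) Q)].
  by apply/mem_set; split; apply/(good_reaches sX).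
pose g : edge (gen_fischer_cover X) := exist _ k kW.
have gin : g \in fset_set [set: edge (gen_fischer_cover X)].
  by rewrite in_fset_set ?inE //; case: (finite_gen_fischer_cover fK).
by exists (FSetSub gin).
Qed.

Lemma edge_shift_cpoint e : edge_shift (gen_fischer_cover X) e ->
  cpoint X (fun i => elab (e i)) (fun i => esrc (e i)).
Proof.
move=> /edge_shiftP he i; split; first exact: esrc_good.
by rewrite -he esrcE.
Qed.

Lemma cpoint_edge_shift x P : cpoint X x P -> exists2 e,
  edge_shift (gen_fischer_cover X) e & forall i, elab (e i) = x i /\ esrc (e i) = P i.
Proof.
move=> cP; have /choice [e eP] i : exists e : gf_edge X,
    [/\ esrc e = P i, elab e = x i & etgt e = P (i + 1)].
  by apply: edge_exists; [exact: (cP _).1 | exact: (cP _).1 | exact: (cP _).2].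
exists e => [|i]; last by have [-> -> _] := eP i.
by apply/edge_shiftP => i; have [_ _ ->] := eP i; have [-> _ _] := eP (i + 1).
Qed.

End Edges.

(** * The generalised left Fischer cover is a cover *)

Lemma finite_graph_sft (A : finType) (G : lgraph A) : sft (edge_shift G).
Proof.
split.
  split; last first.
    move=> e; split=> h i; first exact: h.
    by have := h (i - 1); rewrite /shift subrK.
  apply/closed_eqonP => e he i.
  have [f hf ef] := he (`|i|%N.+2).
  by rewrite !ef ?hf //; lia.
exists [seq [:: p.1; p.2] | p <- enum {: edge_alphabet G * edge_alphabet G} &
  tgt (\val p.1) != src (\val p.2)].
apply/seteqP; split=> e /= he.
- move=> w /mapP [[a b]]; rewrite mem_filter /= => /andP [ab _] -> [i] [ea eb].
  by move/eqP: ab; apply; rewrite ea eb /= addr0 he.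
- move=> i; apply/eqP; apply: contrapT => /negP ne.
  apply: (he [:: e i; e (i + 1)]); last by exists i; rewrite /= addr0.
  by apply/mapP; exists (e i, e (i + 1)) => //; rewrite mem_filter /= ne mem_enum.
Qed.

Lemma cover_map_local (A : finType) (G : lgraph A) (e f : edge_shift G) a b :
  eqon a b (\val e) (\val f) -> eqon a b (label_map e) (label_map f).
Proof. by move=> h i ai ib; rewrite /label_map h. Qed.

Lemma label_map_continuous (A : finType) (G : lgraph A) :
  continuous (@label_map A G).
Proof.
apply/continuous_fullshiftP => e N; exists N => f; exact: cover_map_local.
Qed.

(** For surjectivity, an indecomposable vertex containing the left ray of [x] at [n] extends to a
    point of the cover whose labels agree with [x] left of [n]. A cluster point of these as [n]
    grows has label sequence [x]. *)
Lemma gen_fischer_range (A : finType) (X : set (fullshift A)) :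
  sofic X -> range (@label_map A (gen_fischer_cover X)) = X.
Proof.
move=> soX; have ssX := soX.1; have [cX sX] := ssX.
have fK := sofic_finite_krieger soX.
apply/seteqP; split.
  move=> _ [e _ <-].
  rewrite label_mapE.
  exact: (cpoint_label ssX (edge_shift_cpoint sX (set_valP e))).
move=> x Xx.
have /choice [u uP] : forall n : nat, exists e : fullshift (gf_edge X),
    edge_shift (gen_fischer_cover X) e /\
    forall k, k < n%:Z -> elab (e k) = x k.
  move=> n.
  have [S [KS idS Sx _]] := indec_below fK (krieger_past sX n%:Z Xx) (past_left sX n%:Z Xx).
  have gS : good X S.
    by have [w Xw ew] := kriegerP sX 0 KS; rewrite ew; apply: indec_good; rewrite -?ew.
  have [x' [P [cP _ xx']]] := cpoint_extend ssX fK gS Sx.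
  have [e he eP] := cpoint_edge_shift sX fK cP.
  by exists e; split => // k kn; rewrite (eP k).1 xx'.
have [|e he eu] := cluster_seq (finite_graph_sft (gen_fischer_cover X)).1.1 (u := u).
  by move=> n; exact: (uP n).1.
exists (set_pt he) => //; apply/funext => k.
have [n kn ek] := eu (`|k|%N.+1).
by rewrite /label_map /= ek; [apply: (uP n).2 | |]; lia.
Qed.

Lemma gen_fischer_is_cover : is_cover sofic gen_fischer.
Proof.
move=> A X soX; split.
- exact: finite_graph_sft.
- exact: gen_fischer_range.
- exact: label_map_continuous.
- by move=> y y' e; apply/funext => i; rewrite /= /label_map e.
Qed.

(** * The generalised left Fischer cover is canonical *)

Lemma cpoint_splice (A : finType) (X : set (fullshift A)) x P z j :
  shift_inv X -> cpoint X x P -> P j (left_at z j) ->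
  exists P', cpoint X (splice z j x) P' /\ forall k, j <= k -> P' k = P k.
Proof.
move=> sX cP Pz.
pose fix T (n : nat) := if n is m.+1
  then ray_cons (z (j - m.+1%:Z)) @^-1` T m else P j.
have TS n : T n.+1 = ray_cons (z (j - n.+1%:Z)) @^-1` T n by [].
have Tz n : T n (left_at z (j - n%:Z)).
  elim: n => [|n IH]; first by rewrite subr0.
  rewrite TS /=; have <- := left_at_succ z (j - n.+1%:Z).
  by rewrite (_ : j - n.+1%:Z + 1 = j - n%:Z) //; lia.
have gT n : good X (T n).
  elim: n => [|n IH]; first exact: (cP j).1.
  have := Tz n.+1; rewrite TS => h; exact: (good_pull sX IH h).
exists (fun k => if j <= k then P k else T `|(j - k)%R|%N); split; last first.
  by move=> k ->.
move=> k; have [jk|kj] := leP j k.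
  have -> : j <= k + 1 by lia.
  by rewrite spliceR //; exact: cP.
split; first exact: gT.
have -> : `|(j - k)%R|%N = (`|(j - k - 1)%R|%N).+1 by lia.
rewrite TS (_ : j - _ = k); last by lia.
rewrite spliceL //; have [jk1|kj1] := leP j (k + 1).
  have -> : k + 1 = j by lia.
  by have -> : `|(j - k - 1)%R|%N = 0%N by lia.
by have -> : `|(j - k - 1)%R|%N = `|(j - (k + 1))%R|%N by lia.
Qed.

Lemma lift_shift (A B : finType) r (X : set (fullshift A))
    (Y : set (fullshift B)) C x P y Q :
  shift_inv X -> shift_inv Y -> bicode r X Y C -> lift X Y C x P y Q ->
  lift X Y C (shift x) (fun i => P (i + 1)) (shift y) (fun i => Q (i + 1)).
Proof.
move=> sX sY bC [c l]; split; first exact: (bicode_shift bC c).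
move=> i; have [w [v [cwv wx vy ew ev]]] := l (i + 1).
exists (shift w), (shift v); split.
- exact: (bicode_shift bC cwv).
- by move=> k ki; apply: wx; lia.
- by move=> k ki; apply: vy; lia.
- by rewrite ew -[shift w]/(shiftn 1 w) past_shiftn.
- by rewrite ev -[shift v]/(shiftn 1 v) past_shiftn.
Qed.

Definition cover_lift (A B : finType) (X : set (fullshift A))
    (Y : set (fullshift B)) (C : fullshift A -> fullshift B -> Prop)
    (e : fullshift (gf_edge X)) (f : fullshift (gf_edge Y)) : Prop :=
  [/\ edge_shift (gen_fischer_cover X) e, edge_shift (gen_fischer_cover Y) f &
  lift X Y C (fun i => elab (e i)) (fun i => esrc (e i))
             (fun i => elab (f i)) (fun i => esrc (f i))].

Lemma cover_lift_sym (A B : finType) (X : set (fullshift A))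
    (Y : set (fullshift B)) C e f :
  @cover_lift A B X Y C e f -> @cover_lift B A Y X (fun v w => C w v) f e.
Proof. by move=> [he hf l]; split => //; exact: lift_sym. Qed.

Section CoverBicode.
Variables (A B : finType) (r : nat) (X : set (fullshift A)).
Variables (Y : set (fullshift B)) (C : fullshift A -> fullshift B -> Prop).
Hypotheses (ssX : shift_space X) (ssY : shift_space Y) (bC : bicode r X Y C).

(** An edge is determined by its label and the vertices at [i] and [i + 1]. The latter depends on
    the vertex of [e] at [i + 1 + 3 r], the last coordinate of a half-open window of radius
    [3 r + 2]. *)
Lemma cover_lift_local e f e' f' i :
  @cover_lift A B X Y C e f -> @cover_lift A B X Y C e' f' ->
  eqon (i - (3 * r + 2)%N%:Z) (i + (3 * r + 2)%N%:Z) e e' -> f i = f' i.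
Proof.
move=> [he hf l] [he' hf' l'] ee.
have Q k : i <= k -> k <= i + 1 -> esrc (f k) = esrc (f' k).
  move=> ik ki; apply: (lift_local ssX ssY bC (edge_shift_cpoint ssX.2 he)
    (edge_shift_cpoint ssX.2 he') (edge_shift_cpoint ssY.2 hf)
    (edge_shift_cpoint ssY.2 hf') l l').
    by move=> m m1 m2; rewrite ee //; lia.
  by rewrite ee //; lia.
apply: edge_inj; first by apply: Q; lia.
  apply: (bicode_fwd bC l.1 l'.1) => m m1 m2.
  by rewrite ee //; lia.
rewrite ((edge_shiftP f).1 hf) ((edge_shiftP f').1 hf').
by apply: Q; lia.
Qed.

Lemma cover_lift_total e : finite_set (krieger_vertices Y) ->
  edge_shift (gen_fischer_cover X) e -> exists f, @cover_lift A B X Y C e f.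
Proof.
move=> fY he.
have [y [Q [cQ l]]] := lift_total ssX ssY bC fY (edge_shift_cpoint ssX.2 he).
have [f hf fQ] := cpoint_edge_shift ssY.2 fY cQ.
exists f; split => //.
rewrite (_ : (fun i => elab (f i)) = y); last by apply/funext => i; exact: (fQ i).1.
by rewrite (_ : (fun i => esrc (f i)) = Q) //; apply/funext => i; exact: (fQ i).2.
Qed.

Lemma cover_lift_shift e f : @cover_lift A B X Y C e f ->
  @cover_lift A B X Y C (shift e) (shift f).
Proof.
move=> [he hf l]; split.
- exact: (edge_shift_inv e).1 he.
- exact: (edge_shift_inv f).1 hf.
- exact: (lift_shift ssX.2 ssY.2 bC l).
Qed.

End CoverBicode.

Lemma cover_bicode (A B : finType) (r : nat) (X : set (fullshift A))
    (Y : set (fullshift B)) (C : fullshift A -> fullshift B -> Prop) :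
  shift_space X -> shift_space Y -> finite_set (krieger_vertices X) ->
  finite_set (krieger_vertices Y) -> bicode r X Y C ->
  bicode (3 * r + 2) (edge_shift (gen_fischer_cover X))
    (edge_shift (gen_fischer_cover Y)) (@cover_lift A B X Y C).
Proof.
move=> ssX ssY fX fY bC; have bC' := bicode_sym bC; split.
- by move=> e f [].
- by move=> e f [].
- by move=> e he; exact: (cover_lift_total ssX ssY bC).
- move=> f hf; have [e le] := cover_lift_total ssY ssX bC' fX hf.
  by exists e; exact: (cover_lift_sym le).
- by move=> e f; exact: (cover_lift_shift ssX ssY bC).
- by move=> e f e' f' i; exact: (cover_lift_local ssX ssY bC).
- move=> e f e' f' i l l'.
  exact: (cover_lift_local ssY ssX bC' (cover_lift_sym l) (cover_lift_sym l')).
Qed.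

(** * Uniqueness of the lift *)

Section Uniqueness.
Variables (A B : finType) (X : set (fullshift A)) (Y : set (fullshift B)).
Hypotheses (ssY : shift_space Y) (fY : finite_set (krieger_vertices Y)).
Local Notation GX := (gen_fischer_cover X).
Local Notation GY := (gen_fischer_cover Y).
Implicit Types (f g : edge_shift GX -> edge_shift GY).

Definition same_labels f g := forall e i,
  elab (\val (f e) i) = elab (\val (g e) i).

(* A left ray of [f e] at [j] is the past of a point [h] of the cover of [Y] that
   agrees with [f e] on the right of [j]; then [g] maps the preimage of [h] under
   [f] to a point right asymptotic to [g e] with that same left ray. *)
Lemma lift_vertex_sub f g fi : inverse_conjugacies f fi ->
  shift_commuting g -> continuous g -> same_labels f g ->
  forall e j, esrc (\val (f e) j) `<=` esrc (\val (g e) j).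
Proof.
move=> cf sg cg fg e j y; have [z ->] := left_at_surj y j => fz.
have sGX := (finite_graph_sft GX).1; have sGY := (finite_graph_sft GY).1.
have [r bC] := bicode_of_conjugacy sGX sGY cf.
have [s sP] := block_code sGX ((continuous_set_typeP g).1 cg) sg.
have cpf := edge_shift_cpoint ssY.2 (set_valP (f e)).
have [P' [cP' eP']] := cpoint_splice ssY.2 cpf fz.
have [h hh hP] := cpoint_edge_shift ssY.2 fY cP'.
have [u [u' uu' fu]] := bicode_onto bC hh.
have hf k : j <= k -> h k = \val (f e) k.
  move=> jk; apply: edge_inj.
  - by rewrite (hP k).2 eP'.
  - by rewrite (hP k).1 spliceR.
  - rewrite ((edge_shiftP h).1 hh) ((edge_shiftP _).1 (set_valP (f e))).
    by rewrite (hP _).2 eP' //; lia.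
have ue k : j + r%:Z <= k -> \val u' k = \val e k.
  apply: (bicode_right (bicode_sym bC) (w := h) (w' := \val (f e))) => //.
  - by exists u'.
  - by exists e.
have gue k : j + r%:Z + s%:Z <= k -> \val (g u') k = \val (g e) k.
  by move=> jk; apply: sP => m m1 m2; apply: ue; lia.
have cgu := edge_shift_cpoint ssY.2 (set_valP (g u')).
have cge := edge_shift_cpoint ssY.2 (set_valP (g e)).
have lab k : elab (\val (g u') k) = splice z j (fun i => elab (\val (f e) i)) k.
  by rewrite -fg fu (hP k).1.
(* The edges of [g u'] and [g e] agree from [j + r + s] on; equal labels on the way carry the
   equality of vertices back to [j]. *)
rewrite -(cpoint_eq cgu cge (i := j + r%:Z + s%:Z)); [|lia| |].
- have := cpoint_left_at ssY j cgu; congr (esrc _ _).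
  by apply: eq_left_at => k kj; rewrite lab spliceL.
- by move=> k jk _; rewrite lab spliceR // fg.
- by rewrite gue.
Qed.

Lemma lift_unique f g fi gi : inverse_conjugacies f fi ->
  inverse_conjugacies g gi -> same_labels f g -> f = g.
Proof.
move=> cf cg fg; have [sf cof _ _ _] := cf; have [sg cog _ _ _] := cg.
have gf : same_labels g f by move=> e i; rewrite fg.
have V e j : esrc (\val (f e) j) = esrc (\val (g e) j).
  by apply/seteqP; split; [exact: lift_vertex_sub cf _ _ _ _ _ | exact: lift_vertex_sub cg _ _ _ _ _].
apply/funext => e; apply: val_inj; apply/funext => i; apply: edge_inj => //.
rewrite ((edge_shiftP _).1 (set_valP (f e))) ((edge_shiftP _).1 (set_valP (g e))).
exact: V.
Qed.

End Uniqueness.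

Definition lifts (A B : finType) (X : set (fullshift A)) (Y : set (fullshift B))
    (phi : X -> Y)
    (f : edge_shift (gen_fischer_cover X) -> edge_shift (gen_fischer_cover Y)) :=
  forall e (x : X), \val x = label_map e -> label_map (f e) = \val (phi x).

Lemma label_map_range (A : finType) (X : set (fullshift A)) : sofic X ->
  forall e : edge_shift (gen_fischer_cover X), exists x : X, \val x = label_map e.
Proof.
move=> soX e; have Xe : X (label_map e).
  by rewrite -{1}(gen_fischer_range soX); exists e.
exact: set_pt_exists.
Qed.

Lemma lifts_same_labels (A B : finType) (X : set (fullshift A))
    (Y : set (fullshift B)) (phi : X -> Y) f g : sofic X ->
  lifts phi f -> lifts phi g -> same_labels f g.
Proof.
move=> soX lf lg e i; have [x ex] := label_map_range soX e.
have := etrans (lf e x ex) (esym (lg e x ex)); rewrite !label_mapE => h.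
exact: (congr1 (fun y : fullshift B => y i) h).
Qed.

Lemma cover_lift_lifts (A B : finType) (X : set (fullshift A))
    (Y : set (fullshift B)) (phi : X -> Y) f :
  (forall e, cover_lift (fun x y => exists2 z : X, \val z = x & \val (phi z) = y)
    (\val e) (\val (f e))) -> lifts phi f.
Proof.
move=> lf e x; rewrite !label_mapE => ex.
have [_ _ [[x' ex' <-] _]] := lf e.
by have -> : x = x' by apply: val_inj; rewrite ex ex'.
Qed.

Lemma gen_fischer_canonical : canonical sofic gen_fischer.
Proof.
move=> A B X Y soX soY phi [phi' cphi].
have [ssX ssY] := (soX.1, soY.1).
have [fX fY] := (sofic_finite_krieger soX, sofic_finite_krieger soY).
have [r bC] := bicode_of_conjugacy ssX ssY cphi.
have [f [f' [cf /cover_lift_lifts lf]]] :=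
  conjugacy_of_bicode (cover_bicode ssX ssY fX fY bC).
exists f; split; first by split; [exists f' | exact: lf].
move=> g [[g' cg] lg].
move: lg; cbn [cov_map cov gen_fischer] => lg.
have fg : same_labels f g by refine (lifts_same_labels soX lf _); exact lg.
exact: (lift_unique ssY fY cf cg fg).
Qed.

(** * Parsing expanded sequences *)

(* [p i = (k, s)] says that position [i] of an expanded sequence holds the
   symbol inserted after the [k]-th letter if [s], and the [k]-th letter itself
   otherwise; [d k] tells whether a symbol is inserted after the [k]-th letter. *)
Definition pnext (d : int -> bool) (q : int * bool) : int * bool :=
  if ~~ q.2 && d q.1 then (q.1, true) else (q.1 + 1, false).

Definition pprev (d : int -> bool) (q : int * bool) : int * bool :=
  if q.2 then (q.1, false) else (q.1 - 1, d (q.1 - 1)).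

Definition parse (d : int -> bool) (p : int -> int * bool) : Prop :=
  forall i, ((p i).2 -> d (p i).1) /\ p (i + 1) = pnext d (p i).

Definition psym (A B : Type) (iota diam : A -> B) (x : int -> A)
    (q : int * bool) : B :=
  if q.2 then diam (x q.1) else iota (x q.1).

Implicit Types (d : int -> bool) (p : int -> int * bool).

Lemma int_orbit (T : Type) (P : T -> Prop) (nxt prv : T -> T) (t : T) :
  (forall u, P u -> P (nxt u)) -> (forall u, P u -> P (prv u)) ->
  (forall u, P u -> nxt (prv u) = u) -> P t ->
  exists o : int -> T, o 0 = t /\ forall i, P (o i) /\ o (i + 1) = nxt (o i).
Proof.
move=> Pn Pp np Pt.
have Pi n : P (iter n nxt t) by elim: n => //= n; exact: Pn.
have Pv n : P (iter n prv t) by elim: n => //= n; exact: Pp.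
exists (fun i => match i with Posz n => iter n nxt t | Negz n => iter n.+1 prv t end).
split => // -[n|n]; split; first exact: Pi.
- by rewrite -PoszD addn1.
- exact: (Pv n.+1).
- case: n => [|n]; first by rewrite /= np.
  have -> : Negz n.+1 + 1 = Negz n by lia.
  by rewrite [in RHS]iterS np //; exact: (Pv n.+1).
Qed.

Lemma int_ind_from (P : int -> Prop) i0 : P i0 -> (forall i, P i -> P (i + 1)) ->
  (forall i, P i -> P (i - 1)) -> forall i, P i.
Proof.
move=> P0 Pu Pd i; have -> : i = i0 + (i - i0) by lia.
elim/int_rect: (i - i0) => [|n IH|n IH]; first by rewrite addr0.
- by have := Pu _ IH; rewrite -addrA (_ : n%:Z + 1 = n.+1%:Z) //; lia.
- by have := Pd _ IH; rewrite -addrA (_ : - n%:Z - 1 = - n.+1%:Z) //; lia.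
Qed.

Lemma parse_prev d p i : parse d p -> p i = pprev d (p (i + 1)).
Proof.
move=> hp; have [] := hp i; case: (p i) => k s /= v ->.
case: s v => v; rewrite /pnext /pprev /=; first by rewrite addrK v.
by case dk: (d k) => //=; rewrite addrK dk.
Qed.

Lemma parse_exists d (k : int) (s : bool) (i : int) : (s -> d k) ->
  exists p, parse d p /\ p i = (k, s).
Proof.
move=> v.
have [||||p [p0 hp]] := @int_orbit _ (fun q : int * bool => q.2 -> d q.1) (pnext d) (pprev d) (k, s).
- by move=> [l []] //= vl; rewrite /pnext /=; case: ifP.
- by move=> [l []] //=; rewrite /pprev.
- move=> [l []] /= vl; rewrite /pnext /pprev /=; first by rewrite vl.
  by case: (d (l - 1)) => /=; rewrite ?andbT ?andbF /= subrK.
- exact: v.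
exists (fun j => p (j - i)); split; last by rewrite subrr.
by move=> j; rewrite (_ : j + 1 - i = j - i + 1); [exact: hp | lia].
Qed.

Lemma parse_shiftn d p (j k : int) : parse d p ->
  parse (shiftn k d) (fun i => ((p (i + j)).1 - k, (p (i + j)).2)).
Proof.
move=> hp i /=; have [v e] := hp (i + j).
rewrite (_ : i + 1 + j = i + j + 1); last by lia.
rewrite e /pnext /shiftn /= subrK; split => //.
by case: ifP => //= _; congr pair; lia.
Qed.

Lemma parse_mono d p i (n : nat) : parse d p -> (p i).1 <= (p (i + n%:Z)).1.
Proof.
move=> hp; elim: n => [|n IH]; first by rewrite addr0.
apply: le_trans IH _; rewrite (_ : i + n.+1%:Z = i + n%:Z + 1); last by lia.
by rewrite (hp _).2 /pnext; case: ifP => //= _; lia.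
Qed.

Lemma parse_eq_right d d' p p' i j : parse d p -> parse d' p' -> p i = p' i ->
  (forall k, (p i).1 <= k -> d k = d' k) -> i <= j -> p j = p' j.
Proof.
move=> hp hp' e dd ij; have [n ->] : exists n : nat, j = i + n%:Z.
  by exists `|(j - i)%R|%N; lia.
elim: n {j ij} => [|n IH]; first by rewrite addr0.
rewrite (_ : i + n.+1%:Z = i + n%:Z + 1); last by lia.
by rewrite (hp _).2 (hp' _).2 -IH /pnext dd //; exact: parse_mono.
Qed.

Lemma parse_lt d p i (n : nat) k : parse d p -> p i = (k, false) ->
  (p (i - n.+1%:Z)).1 < k.
Proof.
move=> hp e; elim: n => [|n IH].
  by rewrite (parse_prev _ hp) subrK e /pprev /=; lia.
rewrite (parse_prev _ hp) (_ : i - n.+2%:Z + 1 = i - n.+1%:Z); last by lia.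
by move: IH; rewrite /pprev; case: ifP => //= _; lia.
Qed.

Lemma parse_eq_left d d' p p' i j k : parse d p -> parse d' p' ->
  p i = (k, false) -> p' i = (k, false) ->
  (forall l, l < k -> d l = d' l) -> j <= i -> p j = p' j.
Proof.
move=> hp hp' e e' dd ji; have [n ->] : exists n : nat, j = i - n%:Z.
  by exists `|(i - j)%R|%N; lia.
elim: n {j ji} => [|n IH]; first by rewrite subr0 e e'.
rewrite (parse_prev _ hp) (parse_prev _ hp').
rewrite (_ : i - n.+1%:Z + 1 = i - n%:Z); last by lia.
rewrite -IH /pprev dd //; case: n {IH} => [|n]; first by rewrite subr0 e /=; lia.
by have := parse_lt n hp e; lia.
Qed.

Lemma parse_hits d p i k l : parse d p -> p i = (k, false) -> k <= l ->
  exists2 j, i <= j & p j = (l, false).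
Proof.
move=> hp e kl; have [n ->] : exists n : nat, l = k + n%:Z.
  by exists `|(l - k)%R|%N; lia.
elim: n {l kl} => [|n [j ij ej]]; first by exists i => //; rewrite addr0.
rewrite (_ : k + n.+1%:Z = k + n%:Z + 1); last by lia.
have := (hp j).2; rewrite ej /pnext /=; case: ifP => dk e1; last by exists (j + 1) => //; lia.
by exists (j + 1 + 1); [lia | rewrite (hp _).2 e1].
Qed.

Section ExpandParse.
Variables (A B : finType) (iota diam : A -> B) (D : set A).
Local Notation t := (tau iota diam D).

Lemma size_tau a : size (t a) = (a \in D).+1.
Proof. by rewrite /tau; case: ifP. Qed.

Lemma nth_tau x0 (x : int -> A) (q : int * bool) : (q.2 -> x q.1 \in D) ->
  nth x0 (t (x q.1)) q.2 = psym iota diam x q.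
Proof. by rewrite /tau /psym; case: q => k [] /= => [->|_] //; case: ifP. Qed.

Lemma nth_flatten_mkseq (T : eqType) x0 (f : nat -> seq T) (k m n : nat) :
  (k < n)%N -> (m < size (f k))%N ->
  nth x0 (flatten (mkseq f n)) (size (flatten (mkseq f k)) + m) = nth x0 (f k) m.
Proof.
move=> kn mk; rewrite -(subnKC kn) /mkseq iotaD map_cat flatten_cat.
rewrite -addn1 iotaD map_cat flatten_cat /= cats0 -catA nth_cat.
by rewrite ltnNge leq_addr /= addKn nth_cat mk.
Qed.

Lemma size_flatten_mkseqS (T : eqType) (f : nat -> seq T) k :
  size (flatten (mkseq f k.+1)) = (size (flatten (mkseq f k)) + size (f k))%N.
Proof.
by rewrite /mkseq -addn1 iotaD map_cat flatten_cat size_cat /= cats0.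
Qed.

(** Induction on the distance from the period. To the right, the position is the total length of the
    earlier blocks plus the offset in the current one. To the left the blocks are reversed, so the
    offset is counted from the end of the block. *)
Lemma expandE x p : parse (fun k => x k \in D) p -> p 0 = (0, false) ->
  forall i, expand iota diam D x i = psym iota diam x (p i).
Proof.
move=> hp p0 [m|m].
- have : exists k : nat, [/\ (p m).1 = k, (k + (p m).2 <= m)%N &
      (size (flatten (mkseq (fun k => t (x (Posz k))) k)) + (p m).2)%N = m].
    elim: m => [|m [k [e1 km em]]]; first by exists 0%N; rewrite p0.
    have := (hp m).2; rewrite -PoszD addn1 => ->.
    case: (p m) (hp m).1 e1 km em => k' s /= v ek km em; rewrite ek in v *; rewrite /pnext /=.
    case: s v km em => /= v km em; first last.
      rewrite addn0 in em; case: ifP => xk /=; first by exists k; split => //; lia.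
      exists k.+1; split; [lia | lia |].
      by rewrite size_flatten_mkseqS em size_tau xk; lia.
    exists k.+1; split; [lia | lia |].
    by rewrite size_flatten_mkseqS size_tau v //=; move: em => /=; lia.
  move=> [k [ek km em]]; have v := (hp m).1; rewrite ek in v.
  have sk : ((p m).2 < size (t (x k)))%N.
    by rewrite size_tau; case: ((p m).2) v => // ->.
  have := @nth_flatten_mkseq _ (iota (x 0)) (fun k => t (x (Posz k))) k (p m).2 m.+1.
  rewrite em => /(_ _ sk) e; apply: etrans (e _) _; first by lia.
  by rewrite -ek nth_tau // ek.
- have : exists k : nat, [/\ (p (Negz m)).1 = Negz k, (k <= m)%N &
      (size (flatten (mkseq (fun k => rev (t (x (Negz k)))) k)) +
        ((x (Negz k) \in D) - (p (Negz m)).2))%N = m].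
    elim: m => [|m [k [e1 km em]]].
      exists 0%N; rewrite (parse_prev _ hp) (_ : Negz 0 + 1 = 0) // p0 /pprev /=.
      by split => //; rewrite subnn.
    rewrite (parse_prev _ hp) (_ : Negz m.+1 + 1 = Negz m); last by lia.
    case: (p (Negz m)) (hp (Negz m)).1 e1 km em => k' s /= v ek km em; rewrite ek in v *; rewrite /pprev /=.
    case: s v em => /= v em; first by exists k; split; [| lia | move: em; rewrite v //=; lia].
    exists k.+1; rewrite (_ : Negz k - 1 = Negz k.+1); last by lia.
    split; [by [] | lia |].
    by rewrite size_flatten_mkseqS size_rev size_tau subnn -em subn0 addn0 addnS.
  move=> [k [ek km em]]; have v := (hp (Negz m)).1; rewrite ek in v.
  pose r := ((x (Negz k) \in D) - (p (Negz m)).2)%N.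
  have sk : (r < size (rev (t (x (Negz k)))))%N by rewrite size_rev size_tau /r; lia.
  have := @nth_flatten_mkseq _ (iota (x 0)) (fun k => rev (t (x (Negz k)))) k r m.+1.
  rewrite em => /(_ _ sk) e; apply: etrans (e _) _; first by lia.
  rewrite nth_rev size_tau; last by rewrite /r; lia.
  rewrite -ek subSS -(nth_tau (iota (x 0))) /= ?ek //; congr (nth _ _ _).
  by rewrite /r; case: ((p (Negz m)).2) v => [->//|_]; rewrite subn0 subnn.
Qed.

(** Blocks have length at most two, so position 0 or position -1 carries a letter. Re-indexing so
    that this letter becomes the zeroth one gives an expanded point or its shift. *)
Lemma expansionP (Z : set (fullshift A)) w : shift_inv Z ->
  expansion iota diam D Z w <-> exists z p, [/\ Z z,
    parse (fun k => z k \in D) p & forall i, w i = psym iota diam z (p i)].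
Proof.
move=> sZ; split.
- case=> [[z Zz <-]|[_ [z Zz <-] <-]];
    have [|p [hp p0]] := @parse_exists (fun k => z k \in D) 0 false 0 => //.
    by exists z, p; split => // i; exact: expandE.
  exists z, (fun i => p (i + 1)); split => // i.
  by rewrite /shift (expandE hp).
- move=> [z [p [Zz hp wE]]].
  have [i0 [k [e0 i01]]] : exists i0 k, p i0 = (k, false) /\ (i0 = 0 \/ i0 = -1).
    case e: (p 0) => [k []]; last by exists 0, k; split => //; left.
    exists (-1), k; split; last by right.
    by rewrite (parse_prev _ hp) addNr e.
  have Zk := (X_shiftn sZ k z).1 Zz.
  have hk := parse_shiftn i0 k hp.
  have E i : expand iota diam D (shiftn k z) i = w (i + i0).
    rewrite (expandE hk) ?add0r ?e0 ?subrr //.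
    by rewrite wE /psym /shiftn /= subrK.
  case: i01 E => -> E.
    by left; exists (shiftn k z) => //; apply/funext => i; rewrite E addr0.
  right; exists (expand iota diam D (shiftn k z)); first by exists (shiftn k z).
  by apply/funext => i; rewrite /shift E addrK.
Qed.

Lemma expansion_shift_inv (Z : set (fullshift A)) :
  shift_inv Z -> shift_inv (expansion iota diam D Z).
Proof.
move=> sZ w; rewrite !(expansionP _ sZ); split=> [] [z [p [Zz hp wE]]].
  by exists z, (fun i => p (i + 1)); split => // i; exact: wE.
exists z, (fun i => p (i - 1)); split => // i.
  by rewrite (_ : i + 1 - 1 = i - 1 + 1); [exact: hp | lia].
by have := wE (i - 1); rewrite /shift subrK.
Qed.

End ExpandParse.

(** * Vertices of the cover of a symbol expansion *)

(** Of two consecutive positions at least one carries a letter, so the next and the previous letter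
    are found within distance two. The orbit [pos] lists the positions of the letters, and [y] the
    letters found there. *)
Lemma unparse (E : choiceType) (dd : pred E) (f : int -> E + E) :
  (forall i e, f i = inl e -> dd e -> f (i + 1) = inr e) ->
  (forall i e, f i = inl e -> ~~ dd e -> exists e', f (i + 1) = inl e') ->
  (forall i e, f i = inr e -> exists e', f (i + 1) = inl e') ->
  (forall i e, f i = inr e -> exists2 e', f (i - 1) = inl e' & dd e') ->
  exists y p, parse (fun k => dd (y k)) p /\ forall i, f i = psym inl inr y (p i).
Proof.
move=> f1 f2 f3 f4.
pose P i := exists e, f i = inl e.
pose isl i := if f i is inl _ then true else false.
have islP i : reflect (P i) (isl i).
  rewrite /isl /P; case: (f i) => e; constructor; first by exists e.
  by move=> [].
pose nxt i : int := if isl (i + 1) then i + 1 else i + 2.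
pose prv i : int := if isl (i - 1) then i - 1 else i - 2.
have P2 i : P (i - 1) \/ P i.
  case e : (f i) => [b|b]; first by right; exists b.
  by have [c ec _] := f4 _ _ e; left; exists c.
have Pn i : P i -> P (nxt i).
  move=> _; rewrite /nxt; case: (islP (i + 1)) => // np.
  by have [|//] := P2 (i + 2); rewrite (_ : i + 2 - 1 = i + 1) //; lia.
have Pp i : P i -> P (prv i).
  move=> _; rewrite /prv; case: (islP (i - 1)) => // np.
  by have [|//] := P2 (i - 1); rewrite (_ : i - 1 - 1 = i - 2) //; lia.
have np i : P i -> nxt (prv i) = i.
  move=> Pi; rewrite /nxt /prv; case: (islP (i - 1)) => h.
    by rewrite subrK; case: islP => // /(_ Pi).
  rewrite (_ : i - 2 + 1 = i - 1); last by lia.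
  by case: islP => // _; lia.
have [t Pt] : exists t, P t by have [|] := P2 0; eauto.
have [pos [_ posP]] := int_orbit Pn Pp np Pt.
have /choice [y yP] : forall k, P (pos k) by move=> k; exact: (posP k).1.
have [|p [hp p0]] := @parse_exists (fun k => dd (y k)) 0 false (pos 0) => //.
exists y, p; split => //.
have posS k : pos (k + 1) = nxt (pos k) := (posP k).2.
have fy k : dd (y k) -> f (pos k + 1) = inr (y k) by apply: f1.
have islE i e : f i = inl e -> isl i by rewrite /isl => ->.
have isrE i e : f i = inr e -> isl i = false by rewrite /isl => ->.
have pos2 k : dd (y k) -> pos (k + 1) = pos k + 2.
  by move=> dk; rewrite posS /nxt (isrE _ _ (fy _ dk)).
have pos1 k : ~~ dd (y k) -> pos (k + 1) = pos k + 1.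
  by move=> dk; have [e h] := f2 _ _ (yP k) dk; rewrite posS /nxt (islE _ _ h).
suff H i : i = pos (p i).1 + (p i).2%:Z.
  move=> i; rewrite {1}(H i) /psym; have := (hp i).1.
  by case: (p i).2 => [/(_ isT) /fy //|_]; rewrite addr0.
move: i; apply: (@int_ind_from (fun i => i = pos (p i).1 + (p i).2%:Z) (pos 0)) => [|i IH|i IH].
  by rewrite p0 addr0.
- rewrite (hp i).2 {1}IH /pnext; have := (hp i).1.
  case: (p i) => k [] /= dk; first by rewrite pos2 ?dk //; lia.
  case: (boolP (dd (y k))) => nk /=; first by rewrite addr0.
  by rewrite pos1 //; lia.
- have e1 : i - 1 + 1 = i by lia.
  rewrite (parse_prev _ hp) e1 {1}IH /pprev; have := (hp i).1.
  case: (p i) => k [] /= dk; first by rewrite addr0; lia.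
  have ek : k - 1 + 1 = k by lia.
  case: (boolP (dd (y (k - 1)))) => nk /=.
    by have := pos2 _ nk; rewrite ek; lia.
  by have := pos1 _ nk; rewrite ek; lia.
Qed.

Section Expansion.
Variables (A B : finType) (iota : A -> B) (diam : B) (a : A).
Variable (X : set (fullshift A)).
Hypothesis sX : shift_inv X.
Hypothesis iota_inj : set_inj (symbols X) iota.
Hypothesis symbols_a : symbols X a.
Hypothesis diam_new : ~ (iota @` symbols X) diam.
Local Notation D := [set a].
Local Notation ps := (psym iota (fun=> diam)).
Local Notation parseD z := (parse (fun k => z k \in D)).
Local Notation X' := (expansion iota (fun=> diam) D X).
Implicit Types (z x : fullshift A) (S T : set (ray A)).

Let sX' : shift_inv X' :=
  expansion_shift_inv iota (fun=> diam) D sX.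

Lemma iotaI b c : symbols X b -> symbols X c -> iota b = iota c -> b = c.
Proof. by move=> /mem_set Xb /mem_set Xc; exact: iota_inj. Qed.

Lemma iota_diam b : symbols X b -> iota b <> diam.
Proof. by move=> Xb e; apply: diam_new; exists b. Qed.

Lemma symbols_at z k : X z -> symbols X (z k).
Proof. by move=> Xz; exists z, k. Qed.

Lemma in_D b : (b \in D) = (b == a).
Proof. by apply/idP/eqP => [/set_mem //|->]; exact: mem_set. Qed.

Lemma expansion_parse z p : X z -> parseD z p -> X' (fun i => ps z (p i)).
Proof. by move=> Xz hp; apply/(expansionP _ _ _ _ sX); exists z, p. Qed.

(** The expansion of a left ray. The right half of [glue y y] is a mere filler. *)
Definition enc (y : ray A) : ray B :=
  left_at (expand iota (fun=> diam) D (glue y y)) 0.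

Lemma encE z p i k : parseD z p -> p i = (k, false) ->
  enc (left_at z k) = left_at (fun j => ps z (p j)) i.
Proof.
move=> hp e; rewrite /enc; set u := glue _ _.
have uz l : l < 0 -> u l = z (l + k).
  by case: l => // l _; congr (z _); lia.
have [|q [hq q0]] := @parse_exists (fun k => u k \in D) 0 false 0 => //.
apply/funext => n; rewrite /left_at (expandE _ _ hq q0).
have h1 := parse_shiftn i k hp.
have qE : q (0 - n.+1%:Z) = ((p (0 - n.+1%:Z + i)).1 - k, (p (0 - n.+1%:Z + i)).2).
  apply: (parse_eq_left hq h1 q0); last by lia.
  - by rewrite add0r e subrr.
  - by move=> l l0; rewrite uz.
have := parse_lt n hq q0; rewrite qE /psym /= => lt.
rewrite (_ : i - n.+1%:Z = 0 - n.+1%:Z + i); last by lia.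
by rewrite uz // subrK.
Qed.

Lemma enc_cons b y : enc (ray_cons b y) =
  if b \in D then ray_cons diam (ray_cons (iota b) (enc y))
  else ray_cons (iota b) (enc y).
Proof.
have [z ez] := left_at_surj (ray_cons b y) 1.
have [eb ey] : b = z 0 /\ y = left_at z 0.
  by apply: ray_cons_inj; rewrite ez -left_at_succ add0r.
have [|p [hp p0]] := @parse_exists (fun k => z k \in D) 0 false 0 => //.
have e1 := (hp 0).2; rewrite p0 add0r /pnext /= in e1.
rewrite eb; case: ifP e1 => zD p1.
  have p2 := (hp 1).2; rewrite p1 /pnext /= in p2.
  rewrite -eb ez (encE hp p2) !left_at_succ -[X in left_at _ X]add0r left_at_succ.
  by rewrite ey (encE hp p0) /psym p1 p0 /= -eb.
rewrite -eb ez (encE hp p1) -[X in left_at _ X]add0r left_at_succ.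
by rewrite ey (encE hp p0) /psym p0 /= -eb.
Qed.

Lemma ray_consE (y : ray A) : y = ray_cons (y 0%N) (fun n => y n.+1).
Proof. by apply/funext => -[]. Qed.

(** Every [a] is followed by the new symbol, so an encoded ray never ends in [iota a]. This
    separates the two kinds of vertices below. *)
Lemma enc_head y : symbols X (y 0%N) -> enc y 0%N <> iota a.
Proof.
rewrite [y]ray_consE enc_cons in_D /= => Xy; case: eqP => /= [ya /esym|ya].
  by apply: iota_diam; rewrite -ya.
by move=> e; apply: ya; apply: iotaI e => //; exact: symbols_a.
Qed.

Lemma enc_inj y y' : (forall n, symbols X (y n)) -> (forall n, symbols X (y' n)) ->
  enc y = enc y' -> y = y'.
Proof.
move=> h h' e; apply/funext => n; elim: n y y' h h' e => [|n IH] y y' h h';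
  rewrite (ray_consE y) (ray_consE y') !enc_cons !in_D;
  case: (y 0%N =P a) => ya; case: (y' 0%N =P a) => ya'; lazy iota.
- by rewrite ya ya'.
- by move=> e; case: (iota_diam (h' 0%N)); have [] := ray_cons_inj e.
- by move=> e; case: (iota_diam (h 0%N)); have [] := ray_cons_inj e.
- by move=> e; have [/(iotaI (h 0%N) (h' 0%N))] := ray_cons_inj e.
- move=> e; have [_ e1] := ray_cons_inj e; have [_ e2] := ray_cons_inj e1.
  exact: (IH (fun n => y n.+1) (fun n => y' n.+1)).
- by move=> e; case: (iota_diam (h' 0%N)); have [] := ray_cons_inj e.
- by move=> e; case: (iota_diam (h 0%N)); have [] := ray_cons_inj e.
- move=> e; have [_ e1] := ray_cons_inj e.
  exact: (IH (fun n => y n.+1) (fun n => y' n.+1)).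
Qed.

Lemma krieger_symbols S y : krieger_vertices X S -> S y -> forall n, symbols X (y n).
Proof.
move=> KS; have [x ->] := left_at_surj y 0 => Sx n.
have [w [Xw wx _]] := krieger_splice sX KS Sx.
by rewrite /left_at -wx; [exact: symbols_at | lia].
Qed.

Lemma krieger_enc_inj S T (y u : ray A) : krieger_vertices X S -> krieger_vertices X T ->
  S y -> T u -> enc y = enc u -> y = u.
Proof.
by move=> KS KT Sy Tu; apply: enc_inj; [exact: (krieger_symbols KS) | exact: (krieger_symbols KT)].
Qed.

(** [tauS] gives pasts just before a letter, [hatS] pasts between an [a] and the symbol inserted
    after it. *)
Definition tauS S : set (ray B) := enc @` S.
Definition hatS S : set (ray B) := ray_cons (iota a) @` tauS S.

Lemma tauS_inj S T : krieger_vertices X S -> krieger_vertices X T ->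
  tauS S = tauS T -> S = T.
Proof.
move=> KS KT e; apply/seteqP; split => y hy.
  have [z Tz /esym ez] : tauS T (enc y) by rewrite -e; exists y.
  by have yz := krieger_enc_inj KS KT hy Tz ez; subst z.
have [z Tz /esym ez] : tauS S (enc y) by rewrite e; exists y.
by have yz := krieger_enc_inj KT KS hy Tz ez; subst z.
Qed.

Lemma hatS_inj S T : krieger_vertices X S -> krieger_vertices X T ->
  hatS S = hatS T -> S = T.
Proof.
move=> KS KT e; apply: tauS_inj => //; apply/seteqP; split => y hy.
  have [u Tu eu] : hatS T (ray_cons (iota a) y) by rewrite -e; exists y.
  by have [_ uy] := ray_cons_inj eu; subst u.
have [u Su eu] : hatS S (ray_cons (iota a) y) by rewrite e; exists y.
by have [_ uy] := ray_cons_inj eu; subst u.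
Qed.

Lemma tauS_hatS S T y : krieger_vertices X S -> tauS S y -> hatS T y -> False.
Proof.
move=> KS [z Sz <-] [u _ e].
by apply: (enc_head (krieger_symbols KS Sz 0%N)); rewrite -e.
Qed.

(** The future determines its own parsing: a point of the expansion with this future has a letter at
    [i], and reading on from there its parse and its letters coincide with those of [z]. *)
Lemma past_start z p i k : X z -> parseD z p -> p i = (k, false) ->
  past X' (fun j => ps z (p j)) i = tauS (past X z k).
Proof.
move=> Xz hp e; pose w : fullshift B := fun j => ps z (p j); rewrite -/w; apply/seteqP; split.
- move=> y; have [u ->] := left_at_surj y i.
  move=> /(past_splice sX') /(expansionP _ _ _ _ sX) [z' [p' [Xz' hp' vE]]].
  have vi : ps z' (p' i) = iota (z k) by rewrite -vE spliceR // /w e.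
  have [k' e'] : exists k', p' i = (k', false).
    move: vi; case: (p' i) => k' [] h; last by exists k'.
    by case: (iota_diam (symbols_at k Xz)); rewrite -h.
  (* Re-index the preimage so that its letter at position [i] also has number [k]. *)
  pose c := k' - k; have Xz2 := (X_shiftn sX c z').1 Xz'.
  pose p2 j := ((p' (j + 0)).1 - c, (p' (j + 0)).2).
  pose z2 : fullshift A := shiftn c z'.
  have hp2 : parseD z2 p2 := parse_shiftn 0 c hp'.
  have vE2 j : splice u i w j = ps z2 (p2 j).
    by rewrite vE /p2 /z2 /psym /shiftn /= addr0 subrK.
  have e2 : p2 i = (k, false) by rewrite /p2 addr0 e' /=; congr pair; rewrite /c; lia.
  have same j : i <= j -> p2 j = p j -> ~~ (p j).2 -> z2 (p j).1 = z (p j).1.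
    move=> ij ej ns; have := vE2 j; rewrite spliceR // ej /w /psym (negbTE ns).
    by move=> /esym /iotaI; apply; apply: symbols_at.
  have pE (n : nat) : p2 (i + n%:Z) = p (i + n%:Z).
    elim: n => [|n IH]; first by rewrite addr0 e2 e.
    rewrite (_ : i + n.+1%:Z = i + n%:Z + 1); last by lia.
    rewrite (hp2 _).2 (hp _).2 IH /pnext.
    by case: (boolP (p _).2) => //= ns; rewrite same //; lia.
  have zE l : k <= l -> z l = z2 l.
    move=> kl; have [j ij ej] := parse_hits hp e kl.
    have [n jn] : exists n : nat, j = i + n%:Z by exists `|(j - i)%R|%N; lia.
    by have := same j ij; rewrite ej /= => -> //; rewrite -ej jn pE.
  exists (left_at z2 k).
    by rewrite (eq_past X zE); exact: (past_left sX k Xz2).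
  rewrite (encE hp2 e2); apply: eq_left_at => j ji.
  by rewrite -(vE2 j) spliceL.
- move=> _ [y + <-]; have [x ->] := left_at_surj y k => /(past_splice sX) Xz2.
  have [|p2 [hp2 e2]] := @parse_exists (fun l => splice x k z l \in D) k false i => //.
  have pE j : i <= j -> p j = p2 j.
    apply: (parse_eq_right hp hp2); rewrite e ?e2 // => l kl.
    by rewrite spliceR.
  have wE j : i <= j -> w j = ps (splice x k z) (p2 j).
    move=> ij; rewrite /w -pE // /psym spliceR //.
    have [n ->] : exists n : nat, j = i + n%:Z by exists `|(j - i)%R|%N; lia.
    by have := parse_mono i n hp; rewrite e.
  rewrite (eq_past X' wE) (_ : left_at x k = left_at (splice x k z) k).
    rewrite (encE hp2 e2); exact: (past_left sX' i (expansion_parse Xz2 hp2)).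
  by apply: eq_left_at => l lk; rewrite spliceL.
Qed.

(** The new symbol at [i] forces [iota a] at [i - 1]. Hence all left rays here end in [iota a], and
    the past one position earlier determines this one. *)
Lemma past_diam z p i k : X z -> parseD z p -> p i = (k, true) ->
  past X' (fun j => ps z (p j)) i = hatS (past X z k).
Proof.
move=> Xz hp e; pose w : fullshift B := fun j => ps z (p j); rewrite -/w.
have e1 : p (i - 1) = (k, false) by rewrite (parse_prev _ hp) subrK e.
have zk : z k = a by have := (hp i).1; rewrite e in_D => /(_ isT) /eqP.
have w1 : w (i - 1) = iota a by rewrite /w e1 /psym /= zk.
have pw : past X' w (i - 1) = ray_cons (iota a) @^-1` past X' w i.
  by rewrite (pastS sX') w1 subrK.
rewrite /hatS -(past_start Xz hp e1) -/w pw; apply/seteqP; split; last first.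
  by move=> _ [y hy <-].
move=> y hy; have [u uE] := left_at_surj y i.
have := hy; rewrite uE => /(past_splice sX') /(expansionP _ _ _ _ sX) [z' [p' [Xz' hp' vE]]].
have vi : ps z' (p' i) = diam by rewrite -vE spliceR // /w e.
have [k' e'] : exists k', p' i = (k', true).
  move: vi; case: (p' i) => k' [] h; first by exists k'.
  by case: (iota_diam (symbols_at k' Xz')).
have u1 : u (i - 1) = iota a.
  rewrite -(@spliceL _ u w i); last by lia.
  rewrite vE (parse_prev _ hp') subrK e' /psym /=.
  by have := (hp' i).1; rewrite e' in_D => /(_ isT) /eqP ->.
have yE : y = ray_cons (iota a) (left_at u (i - 1)).
  by rewrite uE -u1 -left_at_succ subrK.
by exists (left_at u (i - 1)) => //=; rewrite -yE.
Qed.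

Lemma past_expansion z p i : X z -> parseD z p ->
  past X' (fun j => ps z (p j)) i =
  (if (p i).2 then hatS else tauS) (past X z (p i).1).
Proof.
move=> Xz hp; case e : (p i) => [k []] /=; first exact: past_diam.
exact: past_start.
Qed.

Lemma krieger_expansion (P : set (ray B)) : krieger_vertices X' P ->
  exists2 S, krieger_vertices X S & P = tauS S \/ P = hatS S.
Proof.
move=> /(kriegerP sX' 0) [w /(expansionP _ _ _ _ sX) [z [p [Xz hp /funext ->]]] ->].
exists (past X z (p 0).1); first exact: krieger_past.
by rewrite past_expansion //; case: ifP => _; [right | left].
Qed.

Lemma finite_krieger_expansion : finite_set (krieger_vertices X) ->
  finite_set (krieger_vertices X').
Proof.
move=> fK; apply: (@sub_finite_set _ _
  (tauS @` krieger_vertices X `|` hatS @` krieger_vertices X)).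
  by move=> P /krieger_expansion [S KS [->|->]]; [left | right]; exists S.
by rewrite finite_setU; split; exact: finite_image.
Qed.

Lemma krieger_tauS S : krieger_vertices X S -> krieger_vertices X' (tauS S).
Proof.
move=> /(kriegerP sX 0) [z Xz ->].
have [|p [hp p0]] := @parse_exists (fun k => z k \in D) 0 false 0 => //.
rewrite -(past_start Xz hp p0); apply: (krieger_past sX').
exact: expansion_parse.
Qed.

(** Decompositions correspond: a piece of [tauS S] cannot be of the form [hatS T], whose rays end in
    [iota a], and [tauS] is injective on vertices. *)
Lemma indec_tauS S : krieger_vertices X S -> indec X S <-> indec X' (tauS S).
Proof.
move=> KS; split=> idS V VK e.
- suff : [set T | krieger_vertices X T /\ V (tauS T)] S by case.
  apply: idS => [T [] //|]; apply/seteqP; split => [y Sy|y [T [KT VT] Ty]].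
    have [P VP Py] : (\bigcup_(P in V) P) (enc y) by rewrite -e; exists y.
    have [T KT [eP|eP]] := krieger_expansion (VK _ VP); last first.
      by exfalso; apply: (tauS_hatS KS (T := T) (y := enc y)); [exists y | rewrite -eP].
    rewrite eP in VP Py; have [z Tz /esym ez] := Py.
    by exists T => //; have yz := krieger_enc_inj KS KT Sy Tz ez; subst z.
  have [z Sz /esym ez] : tauS S (enc y) by rewrite e; exists (tauS T) => //; exists y.
  by have yz := krieger_enc_inj KT KS Ty Sz ez; subst z.
- have [||T VT eT] := idS (tauS @` V).
  + by move=> _ [T VT <-]; apply: krieger_tauS; exact: VK.
  + rewrite e; apply/seteqP; split => [_ [y [T VT Ty] <-]|_ [_ [T VT <-] [y Ty <-]]].
      by exists (tauS T); [exists T | exists y].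
    by exists y => //; exists T.
  + by rewrite -(tauS_inj (VK _ VT) KS eT).
Qed.

End Expansion.

(** * The cover of a symbol expansion *)

Lemma parse_start d p k : parse d p -> exists i, p i = (k, false).
Proof.
move=> hp; have [i0 [k0 e0]] : exists i k, p i = (k, false).
  case e : (p 0) => [l []]; last by exists 0, l.
  by exists (-1), l; rewrite (parse_prev _ hp) addNr e.
move: k; apply: (@int_ind_from _ k0) => [|k [i e]|k [i e]]; first by exists i0.
  by have [|j _ ej] := parse_hits hp e (l := k + 1); [lia | exists j].
have := parse_prev (i - 1) hp; rewrite subrK e /pprev /=.
case: (d (k - 1)) => e1; last by exists (i - 1).
by exists (i - 1 - 1); rewrite (parse_prev _ hp) subrK e1.
Qed.

Lemma edge_rep (A : finType) (X : set (fullshift A)) (e : gf_edge X) :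
  shift_inv X -> exists w, [/\ X w, elab e = w 0, esrc e = past X w 0 &
    etgt e = past X w 1].
Proof.
move=> sX; have [y Sy] := krieger_nonempty sX (good_krieger sX (esrc_good sX e)).
have Ty : etgt e (ray_cons (elab e) y) by move: Sy; rewrite esrcE.
have [x ex] := left_at_surj (ray_cons (elab e) y) 1.
rewrite ex in Ty.
have [w [Xw wx eT]] := krieger_splice sX (good_krieger sX (etgt_good sX e)) Ty.
have ew : elab e = w 0.
  by rewrite wx //; exact: (congr1 (fun r : ray A => r 0%N) ex).
by exists w; split => //; rewrite esrcE // eT ew [RHS](pastS sX) add0r.
Qed.

Section ExpansionCover.
Variables (A B : finType) (iota : A -> B) (diam : B) (a : A).
Variable (X : set (fullshift A)).
Hypothesis sX : shift_inv X.
Hypothesis iota_inj : set_inj (symbols X) iota.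
Hypothesis symbols_a : symbols X a.
Hypothesis diam_new : ~ (iota @` symbols X) diam.
Hypothesis fK : finite_set (krieger_vertices X).
Local Notation D := [set a].
Local Notation ps := (psym iota (fun=> diam)).
Local Notation parseD z := (parse (fun k => z k \in D)).
Local Notation X' := (expansion iota (fun=> diam) D X).
Local Notation tauS := (tauS iota diam a).
Local Notation hatS := (hatS iota diam a).
Implicit Types (z x : fullshift A) (S T : set (ray A)) (e : gf_edge X).

Let sX' : shift_inv X' := expansion_shift_inv iota (fun=> diam) D sX.
Let fK' : finite_set (krieger_vertices X') :=
  finite_krieger_expansion a sX iota_inj diam_new fK.
Let past_at z p (i : int) : X z -> parseD z p ->
    past X' (fun j => ps z (p j)) i =
    (if (p i).2 then hatS else tauS) (past X z (p i).1) :=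
  @past_expansion A B iota diam a X sX iota_inj diam_new z p i.

Lemma tauS_neq_hatS S T : krieger_vertices X S -> tauS S = hatS T -> False.
Proof.
move=> KS e; have [y Sy] := krieger_nonempty sX KS.
have h : tauS S (enc iota diam a y) by exists y.
by apply: (tauS_hatS sX iota_inj symbols_a diam_new KS h (T := T)); rewrite -e.
Qed.

Lemma indec_tauSP S : krieger_vertices X S -> indec X S <-> indec X' (tauS S).
Proof. exact: indec_tauS. Qed.

Lemma good_tauS S : good X S -> good X' (tauS S).
Proof.
move=> [z [i [j [Xz ij -> idj]]]].
have [|p [hp pi]] := @parse_exists (fun k => z k \in D) i false i => //.
have [j' ij' pj] := parse_hits hp pi ij.
exists (fun j => ps z (p j)), i, j'; split => //.
- exact: expansion_parse.
- by rewrite past_at // pi.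
- rewrite past_at // pj /=; apply/indec_tauSP => //; exact: krieger_past.
Qed.

Lemma good_hatS z k : X z -> z k = a -> good X (past X z (k + 1)) ->
  good X' (hatS (past X z k)).
Proof.
move=> Xz zk gT.
have [|p [hp p0]] := @parse_exists (fun k => z k \in D) k false 0 => //.
have p1 := (hp 0).2; rewrite p0 add0r /pnext /= in_D zk eqxx in p1.
have p2 := (hp 1).2; rewrite p1 /pnext /= in p2.
have := past_at 1 Xz hp; rewrite p1 /= => <-.
apply: (@good_past _ _ sX' _ 1 (1 + 1)) => //; first exact: expansion_parse.
by rewrite past_at // p2; exact: good_tauS.
Qed.

Lemma good_of_indec z p (j : int) S : X z -> parseD z p -> 0 <= j ->
  krieger_vertices X S -> tauS S = past X' (fun j => ps z (p j)) 0 ->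
  ~~ (p j).2 -> indec X' (past X' (fun j => ps z (p j)) j) -> good X S.
Proof.
move=> Xz hp j0 KS; rewrite !past_at //.
case e0 : (p 0) => [k []] /=; first by move=> /(tauS_neq_hatS KS).
move=> /(tauS_inj sX iota_inj diam_new KS (krieger_past sX k Xz)) -> /negbTE ->.
move=> /(indec_tauSP (krieger_past sX _ Xz)) idj.
have [n jn] : exists n : nat, j = 0 + n%:Z by exists `|j|%N; lia.
exists z, k, (p j).1; split => //.
by have := parse_mono 0 n hp; rewrite -jn e0.
Qed.

(** Only vertices [tauS T] have their indecomposability tied to [X]. If the indecomposable vertex
    that is reached lies before a new symbol, it is replaced by an indecomposable successor. *)
Lemma tauS_good S : krieger_vertices X S -> good X' (tauS S) -> good X S.
Proof.
move=> KS /(goodP sX' 0) [w [j [X'w j0 eS idj]]].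
have [z [p [Xz hp /funext wE]]] := (expansionP _ _ _ _ sX).1 X'w.
rewrite wE in eS idj; case: (boolP (p j).2) => [pj|pj]; last first.
  exact: (good_of_indec Xz hp j0 KS eS pj idj).
(* Past position [j] comes a new symbol, and the next indecomposable vertex
   starts at a letter. *)
rewrite -wE in eS idj.
have [c [T' [KT' idT' eT']]] := indec_succ sX' fK' (krieger_past sX' j X'w) idj.
pose u : fullshift B := splice w j (fun=> c).
have uE : left_at u (j + 1) = ray_cons c (left_at w j).
  rewrite left_at_succ /u spliceR //; congr ray_cons.
  by apply: eq_left_at => k kj; rewrite spliceL.
have Tu : T' (left_at u (j + 1)).
  by have := past_left sX' j X'w; rewrite eT' uE.
have [w' [X'w' wu eT]] := krieger_splice sX' KT' Tu.
have w'w k : k < j -> w k = w' k by move=> kj; rewrite wu /u ?spliceL //; lia.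
have w'j : w' j = c by rewrite wu /u ?spliceR //; lia.
have pj' : past X' w' j = past X' w j by rewrite (pastS sX') -eT w'j eT'.
have eS' : tauS S = past X' w' 0.
  by rewrite eS; apply: (past_eq_shift sX' j0) => // k _; exact: w'w.
have [z' [p' [Xz' hp' /funext wE']]] := (expansionP _ _ _ _ sX).1 X'w'.
rewrite wE' in eS' pj' eT.
apply: (good_of_indec Xz' hp' (j := j + 1) _ KS eS'); first by lia.
  rewrite (hp' j).2 /pnext; case p'j : (p' j).2 => //.
  move: pj'; rewrite wE !past_at // p'j pj => /tauS_neq_hatS [].
  exact: krieger_past.
by rewrite -eT.
Qed.

(** The second kind names a vertex and no edge of the cover of [X]: all edges labelled [a] with the
    same source begin with this same edge, and only the edge after it reveals the target. *)
Lemma edge_cases (g : gf_edge X') :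
  [\/ exists e, [/\ elab e <> a, esrc g = tauS (esrc e),
        elab g = iota (elab e) & etgt g = tauS (etgt e)],
      exists S, [/\ krieger_vertices X S, esrc g = tauS S,
        elab g = iota a & etgt g = hatS S] |
      exists e, [/\ elab e = a, esrc g = hatS (esrc e),
        elab g = diam & etgt g = tauS (etgt e)]].
Proof.
have [w [X'w]] := edge_rep g sX'; have := etgt_good sX' g.
have [z [p [Xz hp /funext wE]]] := (expansionP _ _ _ _ sX).1 X'w.
rewrite wE => + -> -> etE; rewrite etE !past_at // /psym.
have := (hp 0).2; rewrite add0r => ->; have := (hp 0).1.
have Ez k : good X' (tauS (past X z (k + 1))) -> exists e : gf_edge X,
    [/\ esrc e = past X z k, elab e = z k & etgt e = past X z (k + 1)].
  move=> /(tauS_good (krieger_past sX _ Xz)) gT; apply: edge_exists => //.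
    by apply: (@good_past _ _ sX _ _ (k + 1)) => //; lia.
  exact: pastS.
case: (p 0) => k [] /=; rewrite in_D.
  move=> /(_ isT) /eqP zk /Ez [e [e1 e2 e3]]; apply: Or33.
  by exists e; rewrite e1 e2 e3.
move=> _; rewrite /pnext /= in_D; case: eqP => [zk|zk] /=.
  move=> _; apply: Or32; exists (past X z k); rewrite zk; split => //.
  exact: krieger_past.
move=> /Ez [e [e1 e2 e3]]; apply: Or31.
by exists e; rewrite e1 e2 e3.
Qed.

(* Correspondence between the symbols of the expanded cover of [X] and the edges
   of the cover of the expansion of [X]. *)
Definition edge_rel (f : gf_edge X + gf_edge X) (g : gf_edge X') : Prop :=
  match f with
  | inl e => [/\ esrc g = tauS (esrc e), elab g = iota (elab e) &
      etgt g = if elab e == a then hatS (esrc e) else tauS (etgt e)]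
  | inr e => [/\ elab e = a, esrc g = hatS (esrc e), elab g = diam &
      etgt g = tauS (etgt e)]
  end.

Lemma edge_rel_total f : (forall e, f = inr e -> elab e = a) ->
  exists g, edge_rel f g.
Proof.
have rep e : exists z p, [/\ X z, parseD z p, p 0 = (0, false) &
    [/\ elab e = z 0, esrc e = past X z 0 & etgt e = past X z 1]].
  have [z [Xz e1 e2 e3]] := edge_rep e sX.
  have [|p [hp p0]] := @parse_exists (fun k => z k \in D) 0 false 0 => //.
  by exists z, p.
have hat e : elab e = a -> good X' (hatS (esrc e)).
  move=> ea; have [z [p [Xz _ _ [e1 e2 e3]]]] := rep e.
  rewrite e2; apply: good_hatS => //; first by rewrite -e1.
  by rewrite add0r -e3; exact: etgt_good.
case: f => e fa; have [z [p [Xz hp p0 [e1 e2 e3]]]] := rep e.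
- have p1 := (hp 0).2; rewrite p0 add0r /pnext /= in_D -e1 in p1.
  have [|||g [g1 g2 g3]] := @edge_exists _ X' sX' fK' (tauS (esrc e))
    (if elab e == a then hatS (esrc e) else tauS (etgt e)) (iota (elab e)).
  + exact/good_tauS/esrc_good.
  + by case: eqP => [/hat //|_]; exact/good_tauS/etgt_good.
  + have := pastS sX' (fun j => ps z (p j)) 0; rewrite !past_at // p0 add0r p1 /psym /=.
    by rewrite -e1 -e2; case: eqP => _ /= ->; rewrite ?e3 -?e2.
  + by exists g.
- have ea := fa e erefl.
  have p1 := (hp 0).2; rewrite p0 add0r /pnext /= in_D -e1 ea eqxx in p1.
  have p2 := (hp 1).2; rewrite p1 /pnext /= in p2.
  have [|||g [g1 g2 g3]] := @edge_exists _ X' sX' fK' (hatS (esrc e))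
    (tauS (etgt e)) diam.
  + exact: hat.
  + exact/good_tauS/etgt_good.
  + have := pastS sX' (fun j => ps z (p j)) 1.
    by rewrite !past_at // p1 p2 /psym /= -e2 add0r -e3.
  + by exists g.
Qed.

Lemma edge_rel_fun f g g' : edge_rel f g -> edge_rel f g' -> g = g'.
Proof.
case: f => e /=.
  by move=> [s1 l1 t1] [s2 l2 t2]; apply: edge_inj; rewrite ?s1 ?l1 ?t1.
by move=> [_ s1 l1 t1] [_ s2 l2 t2]; apply: edge_inj; rewrite ?s1 ?l1 ?t1.
Qed.

Let Ksrc e : krieger_vertices X (esrc e) := good_krieger sX (esrc_good sX e).
Let Ktgt e : krieger_vertices X (etgt e) := good_krieger sX (etgt_good sX e).
Let tinj S T := @tauS_inj A B iota diam a X sX iota_inj diam_new S T.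
Let hinj S T := @hatS_inj A B iota diam a X sX iota_inj diam_new S T.

Lemma edge_rel_inr e f g : edge_rel (inr e) g -> edge_rel f g -> f = inr e.
Proof.
move=> [l0 s0 _ t0]; case: f => e' /=.
  by move=> [s _ _]; case: (tauS_neq_hatS (Ksrc e') (etrans (esym s) s0)).
move=> [l s _ t]; congr inr; apply: edge_inj.
- by apply: hinj => //; rewrite -s -s0.
- by rewrite l l0.
- by apply: tinj => //; rewrite -t -t0.
Qed.

(** For the label [a] the edge [g] forgets the target, hence the extra condition; it is supplied by
    the next coordinate of the sequence. *)
Lemma edge_rel_inl e e' g : edge_rel (inl e) g -> edge_rel (inl e') g ->
  (elab e = a -> elab e' = a -> etgt e = etgt e') -> e = e'.
Proof.
move=> [s1 l1 t1] [s2 l2 t2] h.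
have le : elab e = elab e'.
  have sym e0 : symbols X (elab e0).
    by have [z [Xz -> _ _]] := edge_rep e0 sX; exact: symbols_at.
  apply: (iotaI iota_inj) => //; by rewrite -l1 -l2.
apply: edge_inj => //; first by apply: tinj => //; rewrite -s1 -s2.
move: t1 t2; rewrite -le; case: eqP => [la _ _|la t1 t2]; first by apply: h; rewrite -?le.
by apply: tinj => //; rewrite -t1 -t2.
Qed.

Local Notation cX := (edge_shift (gen_fischer_cover X)).
Local Notation cX' := (edge_shift (gen_fischer_cover X')).
Local Notation DE := (symbols cX `&` (@elab A X) @^-1` [set a]).
Local Notation EX := (expansion inl inr DE cX).

Lemma in_DE y k : cX y -> (y k \in DE) = (elab (y k) == a).
Proof.
move=> hy; apply/idP/eqP => [/set_mem [_ //]|ya].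
by apply/mem_set; split => //; exists y, k.
Qed.

Lemma expansion_coverP f : EX f <-> exists y p, [/\ cX y,
  parse (fun k => elab (y k) == a) p & forall i, f i = psym inl inr y (p i)].
Proof.
have cXs : shift_inv cX by exact: edge_shift_inv.
split=> [/(expansionP _ _ _ _ cXs)|] [y [p [hy hp fE]]].
  exists y, p; split => //.
  by rewrite (_ : (fun k => _) = (fun k => y k \in DE)) //; apply/funext => k; rewrite in_DE.
apply/(expansionP _ _ _ _ cXs); exists y, p; split => //.
by rewrite (_ : (fun k => _) = (fun k => elab (y k) == a)) //; apply/funext => k; rewrite in_DE.
Qed.

Definition cover_rel (g : fullshift (gf_edge X'))
    (f : fullshift (gf_edge X + gf_edge X)%type) : Prop :=
  [/\ cX' g, EX f & forall i, edge_rel (f i) (g i)].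

Lemma cover_rel_total f : EX f -> exists g, cover_rel g f.
Proof.
move=> Ef; have [y [p [hy hp fE]]] := (expansion_coverP f).1 Ef.
have /choice [g gf] : forall i, exists g, edge_rel (f i) g.
  move=> i; apply: edge_rel_total => e; rewrite fE /psym.
  by case: (p i) (hp i).1 => k [] //= /(_ isT) /eqP ya [<-].
exists g; split => //; apply/edge_shiftP => i.
have := gf i; have := gf (i + 1); rewrite !fE (hp i).2.
case: (p i) (hp i).1 => k [] /= ya; rewrite /pnext /psym /=.
  by move=> [-> _ _] [_ _ _ ->]; rewrite ((edge_shiftP y).1 hy).
case yk : (elab (y k) == a) => /=; first by move=> [_ -> _ _] [_ _ ->].
by move=> [-> _ _] [_ _ ->]; rewrite ((edge_shiftP y).1 hy).
Qed.

Lemma cover_rel_onto g : cX' g -> exists f, cover_rel g f.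
Proof.
move=> hg; have gS := (edge_shiftP g).1 hg.
(* When [g i] goes from [tauS S] to [hatS S], the edge of the cover of [X] is read off from
   [g (i + 1)], which must carry the new symbol. *)
have /choice [f fP] : forall i, exists f, edge_rel f (g i) /\
    forall e, f = inl e -> elab e = a -> edge_rel (inr e) (g (i + 1)).
  move=> i; have [[e [la s l t]]|[S [KS s l t]]|[e [la s l t]]] := edge_cases (g i).
  - exists (inl e); split; last by move=> _ [<-] /la.
    by split => //; case: eqP.
  - have [[e [_ s1 _ _]]|[T [KT s1 _ _]]|[e [la s1 l1 t1]]] := edge_cases (g (i + 1)).
    + by case: (tauS_neq_hatS (Ksrc e) (T := S)); rewrite -s1 -gS.
    + by case: (tauS_neq_hatS KT (T := S)); rewrite -s1 -gS.
    have eS : esrc e = S by apply: hinj => //; rewrite -s1 -gS.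
    exists (inl e); split; last by move=> _ [<-].
    by split; rewrite ?la ?eqxx ?eS.
  - by exists (inr e).
have fg i : edge_rel (f i) (g i) := (fP i).1.
have notr i S : krieger_vertices X S -> etgt (g i) = tauS S -> exists e, f (i + 1) = inl e.
  move=> KS; rewrite gS; have := fg (i + 1); case: (f (i + 1)) => e; first by exists e.
  by move=> [_ -> _ _] /esym /(tauS_neq_hatS KS).
have [||||y [p [hp fE]]] := @unparse _ (fun e => elab e == a) f.
- move=> i e fi /eqP la; apply: edge_rel_inr (fg _).
  exact: (fP i).2 fi la.
- move=> i e fi la; apply: (notr i (etgt e)) => //.
  by have := fg i; rewrite fi => -[_ _ ->]; rewrite (negbTE la).
- move=> i e fi; apply: (notr i (etgt e)) => //.
  by have := fg i; rewrite fi => -[_ _ _ ->].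
- move=> i e fi; have := fg i; rewrite fi => -[_ s _ _].
  have e1 : etgt (g (i - 1)) = hatS (esrc e) by rewrite gS subrK.
  have := fg (i - 1); case: (f (i - 1)) => e' /=.
    move=> [_ _]; case: ifP => [la _|_]; first by exists e'.
    by rewrite e1 => /esym /(tauS_neq_hatS (Ktgt e')).
  by move=> [_ _ _]; rewrite e1 => /esym /(tauS_neq_hatS (Ktgt e')).
exists f; split => //; apply/expansion_coverP; exists y, p; split => //.
(* Adjacency of [y k] and [y (k + 1)] is seen in [g], directly or across the edge carrying the new
   symbol. *)
apply/edge_shiftP => k; have [i pi] := parse_start k hp.
have := (hp i).2; rewrite pi /pnext /=.
have f0 := fg i; rewrite fE pi /psym /= in f0.
case: ifP => yk p1; last first.
  have f1 := fg (i + 1); rewrite fE p1 /psym /= in f1.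
  case: f0 f1 => _ _; rewrite yk gS => t [s _ _].
  by apply: tinj => //; rewrite -t -s.
have p2 := (hp (i + 1)).2; rewrite p1 /pnext /= in p2.
have f1 := fg (i + 1); rewrite fE p1 /psym /= in f1.
have f2 := fg (i + 1 + 1); rewrite fE p2 /psym /= in f2.
case: f1 f2 => _ _ _; rewrite gS => t [s _ _].
by apply: tinj => //; rewrite -t -s.
Qed.

(** Recovering [f i] takes [g i] and [g (i + 1)]; as windows are half open, radius 2 is the first
    that contains both. *)
Lemma cover_rel_bicode : bicode 2 cX' EX cover_rel.
Proof.
split.
- by move=> g f [].
- by move=> g f [].
- exact: cover_rel_onto.
- exact: cover_rel_total.
- move=> g f [hg Ef gf]; split.
  + exact: (edge_shift_inv g).1 hg.
  + exact: (expansion_shift_inv inl inr DE (edge_shift_inv (X := X)) f).1 Ef.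
  + by move=> i; exact: gf.
- move=> g f g' f' i [_ Ef gf] [_ Ef' gf'] gg.
  have nxt h e (u : fullshift (gf_edge X')) : EX h -> (forall i, edge_rel (h i) (u i)) ->
      h i = inl e -> elab e = a -> etgt (u (i + 1)) = tauS (etgt e).
    move=> /expansion_coverP [y [p [_ hp hE]]] hu hi ea.
    have := hu (i + 1); rewrite hE (hp i).2; move: hi; rewrite hE.
    case: (p i) => k [] //= [ye]; rewrite /pnext ye ea eqxx /psym /= ye.
    by case.
  have g0 : g i = g' i by apply: gg; lia.
  have g1 : g (i + 1) = g' (i + 1) by apply: gg; lia.
  have := gf' i; rewrite -g0; have := gf i.
  case fi : (f i) => [e|e]; last by move=> h h'; rewrite (edge_rel_inr h h').
  case fi' : (f' i) => [e'|e']; last by move=> h h'; have := edge_rel_inr h' h.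
  move=> h h'; congr inl; apply: (edge_rel_inl h h') => la la'.
  have := nxt _ _ _ Ef' gf' fi' la'; rewrite -g1 (nxt _ _ _ Ef gf fi la).
  by move=> /tinj ->.
- move=> g f g' f' i [_ _ gf] [_ _ gf'] ff.
  apply: (@edge_rel_fun (f i)) => //; rewrite ff; [exact: gf' | lia | lia].
Qed.

Lemma cover_rel_label g y : cX y -> cover_rel g (expand inl inr DE y) ->
  (fun i => elab (g i)) = expand iota (fun=> diam) [set a] (fun i => elab (y i)).
Proof.
move=> hy [_ _ gf].
have [|p [hp p0]] := @parse_exists (fun k => y k \in DE) 0 false 0 => //.
have hp' : parseD (fun i => elab (y i)) p.
  by rewrite (_ : (fun k => _) = (fun k => y k \in DE)) //; apply/funext => k; rewrite in_DE // in_D.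
apply/funext => i; rewrite (expandE _ _ hp' p0).
have := gf i; rewrite (expandE _ _ hp p0) /psym.
by case: (p i) => k [] /= [].
Qed.

End ExpansionCover.

Lemma gen_fischer_symbol_expansion : respects_symbol_expansion sofic gen_fischer.
Proof.
move=> A X soX B iota diam a iinj sa dnew.
have [ssX fK] := (soX.1, sofic_finite_krieger soX); have [cX sX] := ssX.
exists (@elab A X); split.
- move=> e [y [i [hy <-]]].
  have Xy := cpoint_label ssX (edge_shift_cpoint sX hy).
  by exists (fun i => elab (y i)), i.
- exact: label_mapE.
have [f [g [cfg fP]]] := conjugacy_of_bicode
  (cover_rel_bicode sX iinj sa dnew fK).
exists f, g; split; first exact: cfg.
move=> y; have [_ _ _ _ gK] := cfg.
have := fP (g (expand_pt inl inr _ y)); rewrite gK.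
move=> /(cover_rel_label (set_valP y)) e.
cbn [cov_map gen_fischer]; rewrite !label_mapE; exact: e.
Qed.

Theorem theorem3p13 :
  is_cover sofic gen_fischer /\ flow_invariant sofic gen_fischer.
Proof.
split; first exact: gen_fischer_is_cover.
by split; [exact: gen_fischer_canonical | exact: gen_fischer_symbol_expansion].
Qed.
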